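(* Let $\mathcal Y$ be a finite reconstruction alphabet, let $\eta\in(0,1)$ be given, and consider the multi-armed bandit problem of sequential lossy compression with reconstruction distribution set $\mathcal P^{(\eta)}(\mathcal Y)$. Assume that the LCB algorithm (defined in the context) is run with the set of actions $\mathcal Q=\{Q_*^{(a)}\}_{a\in[k]}$ being a chosen net of $\mathcal P^{(\eta)}(\mathcal Y)$. Then the pseudo-regret at time horizon $T$ is $$\mathsf{preg}_T=O\left(\left(\Gamma\,T^{|\mathcal Y|}\log T\right)^{1/(|\mathcal Y|+1)}\right),$$ where $$\Gamma:=\frac{1}{\lambda\,\eta^{|\mathcal Y|+1}}\left(\max_{x\in\mathcal X}\sum_{y\in\mathcal Y}\mathbf 1\{\rho(x,y)\le d\}\right)^{(|\mathcal Y|-1)/2}$$ and $\lambda$ is the ratio between the maximal and the minimal gap of the actions (defined in the context).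
   Context: Setting: $\mathcal X$ is a source alphabet with a probability distribution $P_X$, $\rho:\mathcal X\times\mathcal Y\to\mathbb R$ is a distortion measure, $d$ is a distortion level, and for every $x\in\mathcal X$ there is $y\in\mathcal Y$ with $\rho(x,y)\le d$. $[k]=\{1,\dots,k\}$; $\log$ is the natural logarithm. $\mathcal P^{(\eta)}(\mathcal Y)$ is the set of probability distributions $Q$ on $\mathcal Y$ with $Q(y)\ge\eta$ for all $y\in\mathcal Y$. A codebook is an infinite sequence $\mathcal C=(y(1),y(2),\dots)$ in $\mathcal Y$; $\mathcal C\sim Q$ means that its codewords are IID from $Q$. Let $J(x,\mathcal C)=\inf\{j\ge1:\rho(x,y(j))\le d\}$, $p(x,Q)=\mathbb P_{Y\sim Q}[\rho(x,Y)\le d]$, and $\tilde b(Q)=\mathbb E_{X\sim P_X,\,\mathcal C\sim Q}[\log J(X,\mathcal C)]$ with $X,\mathcal C$ independent (the mean cost of $Q$). Net: a net of resolution $\epsilon>0$ is a finite set $\{Q_*^{(a)}\}_{a\in[k]}$ of distributions on $\mathcal Y$ such that for any $Q\in\mathcal P^{(\eta)}(\mathcal Y)$ there is $a\in[k]$ with $\mu(Q,Q_*^{(a)})\le\epsilon$, where $\mu(Q_1,Q_2)=\max_{x\in\mathcal X}\left|\log\frac{p(x,Q_1)}{p(x,Q_2)}\right|$; it then satisfies $|\tilde b(Q)-\tilde b(Q_*^{(a)})|\le\epsilon$. The nets used have cardinality $k=k_*(\epsilon)=\left(\frac1{\eta\epsilon}\sqrt{\max_{x\in\mathcal X}\sum_{y\in\mathcal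 Y}\mathbf 1\{\rho(x,y)\le d\}}\right)^{|\mathcal Y|-1}$. The net is ''chosen'' in the sense that its size $k$ (equivalently its resolution $\epsilon$), which may depend on $T$, is selected by the designer so as to optimize the regret bound. Gaps: $a^*\in\arg\min_{a\in[k]}\tilde b(Q_*^{(a)})$, $\Delta(a)=\tilde b(Q_*^{(a)})-\tilde b(Q_*^{(a^* )})$, and $\lambda>0$, regarded as fixed, is defined by $\max_{a\in[k]}\Delta(a)=\lambda\min_{a\in[k]\setminus\{a^*\}}\Delta(a)$. LCB algorithm: let $\delta_t=t^{-\alpha}$ for a constant $\alpha>2$, and for costs $(B_1,\dots,B_n)$ put $\mathrm{LCB}((B_1,\dots,B_n),\delta,n)=\frac1n\sum_{i=1}^nB_i-\frac c\eta\sqrt{\frac1n\log\frac1\delta}$ (and $-\infty$ if $n=0$). Here $c>0$ is the numerical constant in the following confidence bound: for $\delta\in(0,1)$ and $Q$ with $\min_{x}p(x,Q)>\eta$, if $X_i\sim P_X$ are IID and $\mathcal C_i\sim Q$ are independent codebooks, then with probability $1-\delta$, $\left|\frac1n\sum_{i=1}^n\log J(X_i,\mathcal C_i)-\tilde b(Q)\right|\le\frac c\eta\sqrt{\frac1n\log\frac1\delta}$. At each round $t=1,2,\dots$ the algorithm chooses $A_t\in\arg\min_{a\in[k]}\mathrm{LCB}(\mathcal B_t(a),\delta_t,N_t(a))$, where $\mathcal B_t(a)$ is the list of the costs incurred in the previous rounds in which action $a$ was played and $N_t(a)$ is its length; then a fresh codebook $\mathcal C_t\sim Q_*^{(A_t)}$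 is drawn, a fresh source sample $X_t\sim P_X$ (IID over time) is compressed, and the cost $B_t=\log J(X_t,\mathcal C_t)$ is incurred. Pseudo-regret: $\mathsf{preg}_T=\mathbb E\left[\sum_{t=1}^T\left(\tilde b(Q_*^{(A_t)})-\min_{Q\in\mathcal P^{(\eta)}(\mathcal Y)}\tilde b(Q)\right)\right]$.
   Formalization: Net members are required to satisfy p(x,Q) ≥ η for all x (true for members of P^(η)), since a net with useless arms can have arbitrarily large regret; the confidence bound is assumed only for δ ≤ 1/2; k is k_*(ε) rounded up; T ≥ 2; the O-constant may depend on λ, |Y|, α, c. *)

(* Defs.v *)
From HB Require Import structures.
From mathcomp Require Import all_boot all_order all_algebra.
From mathcomp Require Import all_classical all_reals all_analysis.
From mathcomp Require Import lra.

Set Implicit Arguments.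
Unset Strict Implicit.
Unset Printing Implicit Defensive.

Import Order.TTheory GRing.Theory Num.Theory.

Local Open Scope classical_set_scope.
Local Open Scope ring_scope.

(* Nonempty finite alphabets; the point is only there because a measurableType
   is required to be pointed. *)
#[short(type=pointedFinType)]
HB.structure Definition PointedFinite := {T of Finite T & Pointed T}.

Record dist (R : realType) (Y : finType) := Dist {
  pmf :> Y -> R ;
  pmf_ge0 : forall y, 0 <= pmf y ;
  pmf_sum1 : \sum_(y : Y) pmf y = 1 }.

Definition coordinate_events (Y : Type) : set_system (nat -> Y) :=
  [set S | exists j y, S = [set C : nat -> Y | C j = y]].

(* The codeword y(j), j >= 1, of the codebook C is C j.-1. *)
Definition codebook (Y : Type) := g_sigma_algebraType (@coordinate_events Y).

Definition iid_codewords (R : realType) (Y : pointedFinType) (Q : dist R Y)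
    (P : probability (codebook Y) R) : Prop :=
  forall (m : nat) (w : nat -> Y),
    P [set C | forall j, (j < m)%N -> C j = w j]
    = (\prod_(j < m) Q (w j))%:E.

Section uniform01.
Context (R : realType).

Definition itv01 : set (measurableTypeR R) := `[0, 1[%classic.

Lemma measurable_itv01 : measurable itv01.
Proof. exact: measurable_itv. Qed.

Definition unif01 := mrestr (@lebesgue_measure R) measurable_itv01.

HB.instance Definition _ := Measure.on unif01.

Let unif01T : unif01 setT = 1%:E.
Proof.
rewrite /unif01 /mrestr setTI.
by rewrite /itv01 lebesgue_measure_itv /= lte_fin ltr01 oppr0 adde0.
Qed.

HB.instance Definition _ := Measure_isProbability.Build _ _ _ unif01 unif01T.

End uniform01.

(* Codewords are read off a uniform u in [0, 1[ by iterating the inverse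
   distribution function of Q: the u whose expansion starts with a given word w
   form an interval of length \prod_j Q (w j). *)
Section iid_law.
Context {R : realType} {Y : pointedFinType} (Q : dist R Y).

Let lo (y : Y) : R := \sum_(z : Y | (enum_rank z < enum_rank y)%N) Q z.

Let letter (u : R) : Y := odflt point [pick y | lo y <= u < lo y + Q y].

Let rest (u : R) : R := (u - lo (letter u)) / Q (letter u).

Let expansion (u : R) : nat -> Y := fun j => letter (iter j rest u).

Let lo_ge0 y : 0 <= lo y.
Proof. by apply: sumr_ge0 => z _; exact: pmf_ge0. Qed.

Let loS y z : (enum_rank y < enum_rank z)%N -> lo y + Q y <= lo z.
Proof.
move=> yz; rewrite /lo [leRHS](bigD1 y)//= [leRHS]addrC lerD2r.
rewrite big_mkcond [leRHS]big_mkcond /=; apply: ler_sum => x _.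
case: ifPn => [xy|_]; last by case: ifP => // _; exact: pmf_ge0.
rewrite (ltn_trans xy yz) /=; case: eqVneq => // xE.
by rewrite xE ltnn in xy.
Qed.

Let lo_le1 y : lo y + Q y <= 1.
Proof.
rewrite -(pmf_sum1 Q) [leRHS](bigD1 y)//= [leRHS]addrC lerD2r /lo.
rewrite big_mkcond [leRHS]big_mkcond /=; apply: ler_sum => x _.
case: ifPn => [xy|_]; last by case: ifP => // _; exact: pmf_ge0.
by case: eqVneq => // xE; rewrite xE ltnn in xy.
Qed.

Let letterP u y : lo y <= u < lo y + Q y -> letter u = y.
Proof.
move=> /andP[uy yu]; rewrite /letter; case: pickP => [z /andP[uz zu]|/(_ y)]/=.
  have [yz|zy|/val_inj/enum_rank_inj//] := ltngtP (enum_rank y) (enum_rank z).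
  - by exfalso; have := loS yz; lra.
  - by exfalso; have := loS zy; lra.
by rewrite uy yu.
Qed.

Let letter_ex u : 0 <= u < 1 -> exists y, lo y <= u < lo y + Q y.
Proof.
move=> /andP[u0 u1].
have [y uy ymax] : exists2 y, lo y <= u & forall z, lo z <= u ->
    (enum_rank z <= enum_rank y)%N.
  have n0 : (0 < #|Y|)%N by apply/card_gt0P; exists point.
  pose y0 := enum_val (Ordinal n0).
  have y0u : lo y0 <= u.
    rewrite /lo big_pred0// => z; rewrite enum_valK; apply: negbTE.
    by rewrite -leqNgt.
  case: (@arg_maxnP _ y0 (fun y => lo y <= u) enum_rank y0u) => y uy ymax.
  by exists y => // z zu; exact: ymax.
exists y; rewrite uy /= ltNge; apply/negP => yu.
have [yn|yn] := ltnP (enum_rank y).+1 #|Y|.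
  pose z := enum_val (Ordinal yn).
  have : lo z <= u.
    apply: le_trans yu; rewrite /lo (bigD1 y) ?enum_valK//= addrC lerD2r.
    rewrite big_mkcond [leRHS]big_mkcond /=; apply: ler_sum => x _.
    rewrite ltnS leq_eqVlt.
    have [->|xy] := eqVneq x y; first by rewrite andbF ltnn.
    rewrite andbT; case: ifPn; last by case: ifP => // _ _; exact: pmf_ge0.
    by case/orP => [/eqP/val_inj/enum_rank_inj/eqP|->//]; rewrite (negbTE xy).
  by move=> /ymax; rewrite enum_valK /= ltnn.
suff : lo y + Q y = 1 by move=> yE; move: yu u1; rewrite yE; lra.
rewrite -(pmf_sum1 Q) [RHS](bigD1 y)//= [RHS]addrC; congr (_ + _).
apply: eq_bigl => z; apply/idP/idP => [zy|zy].
  by apply/eqP => zE; rewrite zE ltnn in zy.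
rewrite ltn_neqAle; apply/andP; split.
  by apply: contra zy => /eqP/val_inj/enum_rank_inj ->.
by rewrite -ltnS (leq_trans _ yn)// ltnS.
Qed.

Let restP u y : 0 <= u < 1 -> letter u = y ->
  [/\ 0 < Q y, u = lo y + Q y * rest u & 0 <= rest u < 1].
Proof.
move=> u01 uy; have [z zu] := letter_ex u01.
have yz : y = z by rewrite -uy; exact: letterP.
subst z; have Qy : 0 < Q y by move: zu => /andP[]; lra.
move: zu => /andP[zu uz].
split => //; rewrite /rest uy.
  by rewrite mulrC divfK ?gt_eqF// addrC subrK.
by rewrite divr_ge0 ?(ltW Qy) ?subr_ge0//= ltr_pdivrMr// mul1r ltrBlDl.
Qed.

Let expansionS u j : expansion u j.+1 = expansion (rest u) j.
Proof. by rewrite /expansion iterSr. Qed.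

Let expansion_itv m (w : nat -> Y) : exists a, [/\ 0 <= a,
  a + \prod_(j < m) Q (w j) <= 1 &
  forall u, (0 <= u < 1 /\ forall j, (j < m)%N -> expansion u j = w j) <->
    a <= u < a + \prod_(j < m) Q (w j)].
Proof.
elim: m w => [|m IH] w.
  exists 0; rewrite big_ord0 add0r; split => // u.
  by split => [[]|?].
have [a [a0 a1 aE]] := IH (fun j => w j.+1).
rewrite big_ord_recl /=.
set p := \prod_(_ < _) _; rewrite -/p in a1 aE.
have p0 : 0 <= p by apply: prodr_ge0 => i _; exact: pmf_ge0.
have q0 := pmf_ge0 Q (w 0%N); have := lo_ge0 (w 0%N); have := lo_le1 (w 0%N).
set q := Q (w 0%N) in q0 *; set l := lo (w 0%N) => l1 l0.
exists (l + q * a); split; [nra|nra|] => u; split.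
  move=> [u01 uw]; have [Q0 uE r01] := restP u01 (uw 0%N isT).
  have /aE : 0 <= rest u < 1 /\ forall j, (j < m)%N -> expansion (rest u) j = w j.+1.
    by split => // j jm; rewrite -expansionS; exact: uw.
  move=> /andP[ar ra]; rewrite uE -/l -/q -/q in Q0 *.
  by apply/andP; split; nra.
move=> /andP[au ua].
have Q0 : 0 < q by rewrite lt_neqAle q0 andbT; apply/eqP => qE; move: au ua; rewrite -qE; lra.
have lu : letter u = w 0%N.
  by apply: letterP; rewrite -/l -/q; apply/andP; split; nra.
have u01 : 0 <= u < 1 by apply/andP; split; nra.
have [_ uE r01] := restP u01 lu; rewrite -/l -/q in uE.
have /aE[_ rw] : a <= rest u < a + p.
  rewrite -(ler_pM2l Q0) -(ltr_pM2l Q0); apply/andP; split; lra.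
by split => // -[|j] jm; [exact: lu|rewrite expansionS; exact: rw].
Qed.

Let draw (u : R) : codebook Y :=
  if 0 <= u < 1 then expansion u else (fun=> point).

Let itv01 := @itv01 R.

Let itv01P (u : R) : itv01 u <-> (0 <= u < 1).
Proof. by rewrite /itv01 /Defs.itv01 /= in_itv. Qed.

Let draw_word m (w : nat -> Y) : exists a, [/\ 0 <= a,
  a + \prod_(j < m) Q (w j) <= 1 &
  draw @^-1` [set C | forall j, (j < m)%N -> C j = w j] `&` itv01
  = `[a, a + \prod_(j < m) Q (w j)[%classic].
Proof.
have [a [a0 a1 aE]] := expansion_itv m w; exists a; split => //.
apply/seteqP; split => u; rewrite /= in_itv /=.
  by move=> [uw /itv01P u01]; apply/aE; split => //; move: uw; rewrite /draw u01.
by move=> /aE[u01 uw]; split; [rewrite /draw u01|apply/itv01P].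
Qed.

Let measurable_draw : measurable_fun [set: measurableTypeR R] draw.
Proof.
apply: (@measurability _ _ (measurableTypeR R) (codebook Y) setT draw (@coordinate_events Y)) => //.
move=> _ [_ [j [y ->]] <-]; rewrite setTI.
rewrite -(setUIDK (draw @^-1` _) itv01).
apply: measurableU; last first.
  have [->|yp] := eqVneq y point.
    suff -> : draw @^-1` [set C | C j = point] `\` itv01 = ~` itv01.
      by apply: measurableC; exact: measurable_itv01.
    apply/seteqP; split => u /=; first by case.
    move=> u01; split => //; rewrite /draw.
    by case: ifPn => // u01'; case: u01; apply/itv01P.
  rewrite [X in measurable X](_ : _ = set0)//.
  rewrite -subset0 => u /= [] /[swap] u01; rewrite /draw; case: ifPn => [u01' _|].
    by case: u01; apply/itv01P.
  by move=> _ /esym/eqP; rewrite (negbTE yp).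
rewrite [X in measurable X](_ : _ = \bigcup_(w in [set w : {ffun 'I_j.+1 -> Y} | w ord_max = y])
  (draw @^-1` [set C | forall i, (i < j.+1)%N -> C i = w (inord i)] `&` itv01)).
  apply: fin_bigcup_measurable => [|w _]; first exact: finite_finset.
  have [a [_ _ ->]] := draw_word j.+1 (fun i => w (inord i)).
  exact: measurable_itv.
apply/seteqP; split => u /=.
  move=> [uy u01]; exists [ffun i : 'I_j.+1 => draw u i]; rewrite /= ?ffunE//.
  by split => // i ij; rewrite ffunE inordK.
move=> [w /= <- [uw u01]]; split => //; rewrite uw//; congr (w _).
by apply: val_inj; rewrite /= inordK.
Qed.

Let mdraw : {mfun measurableTypeR R >-> codebook Y} :=
  HB.pack draw (isMeasurableFun.Build _ _ _ _ _ measurable_draw).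

Let U : probability (measurableTypeR R) R := @unif01 R.

Lemma iid_law_exists :
  exists P : probability (codebook Y) R, iid_codewords Q P.
Proof.
exists (distribution U mdraw) => m w.
have [a [a0 a1 aE]] := draw_word m w.
rewrite [LHS](_ : _ = lebesgue_measure `[a, a + \prod_(j < m) Q (w j)[%classic).
  rewrite lebesgue_measure_itv /= lte_fin.
  have p0 : 0 <= \prod_(j < m) Q (w j).
    by apply: prodr_ge0 => i _; exact: pmf_ge0.
  case: ifPn => [_|]; first by rewrite -EFinB [a + _]addrC addrK.
  rewrite ltrDl -leNgt => p0'; congr EFin; apply/eqP.
  by rewrite eq_le p0 p0'.
by rewrite -aE.
Qed.

End iid_law.

(* The law of a codebook C ~ Q. A probability on codebook Y is determined by
   iid_codewords, since the events there form a generating pi-system. *)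
Definition codebook_law (R : realType) (Y : pointedFinType) (Q : dist R Y) :
    probability (codebook Y) R :=
  projT1 (cid (iid_law_exists Q)).

Lemma codebook_lawP (R : realType) (Y : pointedFinType) (Q : dist R Y) :
  iid_codewords Q (codebook_law Q).
Proof. exact: (projT2 (cid (iid_law_exists Q))). Qed.

Section compression.
Context {R : realType} {Y : pointedFinType} {dX : measure_display}
  {X : measurableType dX} (rho : X -> Y -> R) (D : R).

(* Infinite when no codeword is within distortion D of x. *)
Definition first_match (x : X) (C : codebook Y) : \bar R :=
  ereal_inf [set j.+1%:R%:E | j in [set j : nat | rho x (C j) <= D]].

Definition cost (x : X) (C : codebook Y) : \bar R := lne (first_match x C).

Definition match_prob (x : X) (Q : dist R Y) : R :=
  \sum_(y : Y | rho x y <= D) Q y.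

Definition mean_cost (PX : probability X R) (Q : dist R Y) : \bar R :=
  (\int[PX \x codebook_law Q]_z cost z.1 z.2)%E.

(* x ranges over an arbitrary X, but the quantities below depend on x only
   through the subset of those y with rho x y <= D, so they take finitely many
   values and the suprema are maxima. *)
Definition net_dist (Q1 Q2 : dist R Y) : R :=
  sup (range (fun x => `|ln (match_prob x Q1 / match_prob x Q2)|)).

Definition max_ball : R :=
  sup (range (fun x => \sum_(y : Y) (nat_of_bool (rho x y <= D))%:R)).

Definition floored (eta : R) : set (dist R Y) :=
  [set Q | forall y, eta <= Q y].

Definition is_net (eta eps : R) k (Q : 'I_k -> dist R Y) : Prop :=
  forall Q0, floored eta Q0 -> exists a, net_dist Q0 (Q a) <= eps.

Definition net_size (eta eps : R) : R :=
  ((eta * eps)^-1 * Num.sqrt max_ball) ^+ #|Y|.-1.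

(* match_prob >= eta is the domain on which the confidence radius below is
   meaningful; it holds for every member of floored eta as soon as each x has
   some y with rho x y <= D. It rules out arms of infinite mean cost. *)
Definition net_used (eta eps : R) k (Q : 'I_k -> dist R Y) : Prop :=
  [/\ is_net eta eps Q,
      forall a x, eta <= match_prob x (Q a) &
      k%:Z = Num.ceil (net_size eta eps)].

Definition gap (PX : probability X R) k (Q : 'I_k -> dist R Y) (astar a : 'I_k)
    : \bar R :=
  (mean_cost PX (Q a) - mean_cost PX (Q astar))%E.

Definition best_arm (PX : probability X R) k (Q : 'I_k -> dist R Y)
    (astar : 'I_k) : Prop :=
  forall a, (mean_cost PX (Q astar) <= mean_cost PX (Q a))%E.

(* With a single arm there is no gap to compare, and lambda is unconstrained. *)
Definition gap_ratio (PX : probability X R) k (Q : 'I_k -> dist R Y)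
    (astar : 'I_k) (lambda : R) : Prop :=
  (1 < k)%N ->
  ereal_sup (range (gap PX Q astar)) =
  (lambda%:E * ereal_inf [set gap PX Q astar a | a in [set a | a != astar]])%E.

Definition Gamma (eta lambda : R) : R :=
  (lambda * eta ^+ #|Y|.+1)^-1 * max_ball `^ ((#|Y|.-1)%:R / 2).

Definition conf_radius (c eta : R) (n : nat) (delta : R) : R :=
  c / eta * Num.sqrt (n%:R^-1 * ln delta^-1).

Definition confidence_bound (PX : probability X R) (c eta : R) (Q : dist R Y)
    (n : nat) (delta : R) : Prop :=
  forall (dO : measure_display) (Omega : measurableType dO)
    (P : probability Omega R)
    (Xs : 'I_n -> {RV P >-> X}) (Cs : 'I_n -> {RV P >-> codebook Y}),
  (forall (U : 'I_n -> set X) (V : 'I_n -> set (codebook Y)),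
     (forall i, measurable (U i)) -> (forall i, measurable (V i)) ->
     P [set w | forall i, U i (Xs i w) /\ V i (Cs i w)] =
     \prod_(i < n) (PX (U i) * codebook_law Q (V i)))%E ->
  ((1 - delta)%:E <=
   P [set w | `| (n%:R^-1)%:E * \sum_(i < n) cost (Xs i w) (Cs i w)
                 - mean_cost PX Q | <= (conf_radius c eta n delta)%:E])%E.

Definition lcb (c eta : R) (s : seq (\bar R)) (delta : R) : \bar R :=
  if s is [::] then -oo%E else
  (((size s)%:R^-1)%:E * (\sum_(b <- s) b)
   - (conf_radius c eta (size s) delta)%:E)%E.

Section bandit.
Context {dO : measure_display} {Omega : measurableType dO}
  {P : probability Omega R} (k : nat) (Q : 'I_k -> dist R Y)
  (A : nat -> Omega -> 'I_k) (Xs : nat -> {RV P >-> X})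
  (Cs : nat -> {RV P >-> codebook Y}).

(* Rounds are numbered from 1; the values of A, Xs and Cs at 0 are unused. *)
Definition arm_costs (t : nat) (a : 'I_k) (w : Omega) : seq (\bar R) :=
  [seq cost (Xs s w) (Cs s w) | s <- index_iota 1 t & A s w == a].

(* Everything up to and including the choice of A t, but not yet Xs t, Cs t;
   the choice among tied arms is thus allowed to be randomized. *)
Definition history (t : nat) : set_system Omega :=
  <<s [set E | (exists s a, (1 <= s <= t)%N /\ E = A s @^-1` [set a]) \/
               (exists s U, [/\ (1 <= s < t)%N, measurable U &
                             E = Xs s @^-1` U]) \/
               (exists s V, [/\ (1 <= s < t)%N, measurable V &
                             E = Cs s @^-1` V])] >>.

Record lcb_run (PX : probability X R) (alpha c eta : R) : Prop := LcbRun {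
  arm_measurable : forall t a, measurable (A t @^-1` [set a]) ;
  arm_lcb : forall t a w, (1 <= t)%N ->
    (lcb c eta (arm_costs t (A t w) w) (t%:R `^ (- alpha)) <=
     lcb c eta (arm_costs t a w) (t%:R `^ (- alpha)))%E ;
  (* given the history, X_t ~ PX and C_t ~ Q (A_t) are independent *)
  fresh_draws : forall t a E U V, (1 <= t)%N -> history t E ->
    measurable U -> measurable V ->
    P (E `&` A t @^-1` [set a] `&` Xs t @^-1` U `&` Cs t @^-1` V) =
    (P (E `&` A t @^-1` [set a]) * (PX U * codebook_law (Q a) V))%E }.

Definition pseudo_regret (PX : probability X R) (eta : R) (T : nat) : \bar R :=
  (\int[P]_w \sum_(1 <= t < T.+1)
     (mean_cost PX (Q (A t w)) -
      ereal_inf [set mean_cost PX Q0 | Q0 in floored eta]))%E.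

End bandit.
End compression.

(* The radius does not involve a factor 2 inside the logarithm, so no c can
   work for delta close to 1, where it tends to 0 while log J is discrete. *)
Definition confidence_constant (R : realType) (c : R) : Prop :=
  0 < c /\
  forall (Y : pointedFinType) (dX : measure_display) (X : measurableType dX)
    (rho : X -> Y -> R) (D : R) (PX : probability X R) (eta : R)
    (Q : dist R Y) (n : nat) (delta : R),
  (forall y, measurable_fun setT (rho ^~ y)) ->
  0 < eta < 1 -> (forall x, eta < match_prob rho D x Q) ->
  (0 < n)%N -> 0 < delta <= 2^-1 ->
  confidence_bound rho D PX c eta Q n delta.

(* Main.v *)
(* The nets exist because rounding a distribution by largest remainders to a grid
   of step 1/n perturbs the probability of every event by at most |Y|/(4n), and
   a grid of step of order the resolution has few enough points.  The mean cost
   is 1-Lipschitz in the log of the match probability p: by summation by parts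
   E[log J] = sum_{j>=1} log(1+1/j) (1-p)^j, each weight is at most 1/j, and
   sum_{j>=1} (1-p)^j / j = - log p.  The costs of the successive plays of an arm
   become a full i.i.d. sample once the plays that never happen are replaced by
   independent draws, so the confidence bound holds for the adaptively collected
   costs; a union bound and sum_n n^(-1/2) then give a regret of order
   sqrt(k T log T) / eta against the best arm.  Balancing this with the
   discretization error eps T, at k of order (sqrt M / (eta eps))^(|Y|-1), gives
   the rate.  The gap ratio lambda only enters through the constant. *)

Require Import Defs.
From HB Require Import structures.
From mathcomp Require Import all_boot all_order all_algebra.
From mathcomp Require Import all_classical all_reals all_analysis.
From mathcomp Require Import measurable_realfun lra ring.

Set Implicit Arguments.
Unset Strict Implicit.
Unset Printing Implicit Defensive.

Import Order.TTheory GRing.Theory Num.Theory.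

Local Open Scope classical_set_scope.
Local Open Scope ring_scope.

(** * Nets of floored distributions *)

(** A net must have exactly the rounded-up prescribed cardinality, so the grid has to be counted
    with explicit constants. With [M] for [max_ball] and [r = eta * eps / sqrt M], the count is
    available for [r <= 1/12], which leads to a separate one-arm net for larger [r]. In the
    concentration argument the obstacle is that the confidence bound speaks of a fixed number [n] of
    draws, while the number of plays of an arm is random and depends on the costs already seen. The
    probability space is therefore enlarged by a factor carrying the replacement draws, the bound is
    applied to the first [n] entries of the completed sequence, and the result is used on the event
    of exactly [n] plays; hence a union over [n] as well as over arms and rounds. When [k log T]
    exceeds [T], each round is charged the bound [-log eta] on the mean cost instead. *)

Lemma ffact_le_expn (n m : nat) : (n ^_ m <= n ^ m)%N.
Proof.
elim: m n => [//|m IH] n; rewrite ffactnS expnS leq_mul2l; apply/orP; right.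
by apply: (leq_trans (IH _)); case: m {IH} => [//|m]; rewrite leq_exp2r ?leq_pred.
Qed.

(** * Largest-remainder rounding and the number of grid points *)

Section rounding.
Context {R : realType}.

Lemma expR1_le3 : expR 1 <= 3 :> R.
Proof.
(* This is [exp (-1/8) >= 1 - 1/8] inverted; its eighth power is below 3. *)
have h : expR (8%:R^-1) <= 8%:R / 7%:R :> R.
  rewrite -[leLHS]invrK -expRN -[leRHS]invrK lef_pV2 ?posrE ?expR_gt0//.
  by apply: le_trans (expR_ge1Dx _); lra.
rewrite [X in expR X](_ : 1 = 8%:R * 8%:R^-1); last by lra.
rewrite expRM_natl; apply: (@le_trans _ _ ((8%:R / 7%:R) ^+ 8)).
  by rewrite lerXn2r ?nnegrE ?expR_ge0//; lra.
by lra.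
Qed.

(** This is [(1 + 1/n)^n <= e <= 3], cleared of the denominator so as to cover [n = 0]. *)
Lemma succ_pow_le3 (n : nat) : n.+1%:R ^+ n <= 3 * n%:R ^+ n :> R.
Proof.
case: n => [|n]; first by rewrite !expr0; lra.
set m := n.+1; have m0 : 0 < m%:R :> R by rewrite ltr0n.
rewrite -ler_pdivrMr ?exprn_gt0// -expr_div_n.
apply: (le_trans _ expR1_le3).
rewrite [X in expR X](_ : 1 = m%:R * m%:R^-1); last by rewrite divff ?gt_eqF.
rewrite expRM_natl lerXn2r ?nnegrE ?expR_ge0 ?divr_ge0//.
by apply: le_trans (expR_ge1Dx _); rewrite -natr1 mulrDl divff ?gt_eqF// mul1r.
Qed.

(** A Stirling-type bound: each induction step loses the factor [(1 + 1/(N+1))^(N+1) <= 3]. The base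
    [N+1] is the size of the alphabet when [N = |Y| - 1]. *)
Lemma pow_le_fact (N : nat) : (N.+1%:R / 3) ^+ N <= N`!%:R :> R.
Proof.
elim: N => [|N IH]; first by rewrite expr0.
rewrite factS natrM.
have h := succ_pow_le3 N.+1.
have N0 : 0 <= N.+1%:R :> R by [].
have i3 : 0 <= 3^-1 ^+ N.+1 :> R by rewrite exprn_ge0.
rewrite exprMn; apply: (le_trans (ler_wpM2r i3 h)).
have -> : 3 * N.+1%:R ^+ N.+1 * 3^-1 ^+ N.+1 = N.+1%:R * (N.+1%:R / 3) ^+ N :> R.
  by rewrite !exprS exprMn; field.
exact: ler_wpM2l.
Qed.

Lemma exists_top_set (Y : finType) (f : Y -> R) (e : nat) : (e <= #|Y|)%N ->
  exists U : {set Y}, #|U| = e /\ forall u v, u \in U -> v \notin U -> f v <= f u.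
Proof.
elim: e => [|e IH] eY; first by exists finset.set0; rewrite cards0; split=> // u v; rewrite inE.
have [U [Ue Uf]] := IH (ltnW eY).
have /card_gt0P[y0 y0U] : (0 < #|~: U|)%N by rewrite cardsCs finset.setCK Ue subn_gt0.
case: (@Order.TotalTheory.arg_maxP _ _ _ y0 (fun y => y \in ~: U) f y0U) => y yU ymax.
exists (y |: U); split; first by rewrite cardsU1 Ue; move: yU; rewrite inE => ->.
move=> u v; rewrite !inE negb_or => /orP[/eqP->|uU] /andP[vy vU]; last exact: Uf.
by apply: ymax; rewrite inE.
Qed.

(* With e units left to distribute, the |Y| - e fractional parts that are not
   rounded up are the smallest ones, so they sum to at most e (|Y| - e) / |Y|. *)
Lemma largest_remainder (Y : finType) (q : Y -> R) (n : nat) :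
  (forall y, 0 <= q y) -> \sum_y q y = n%:R ->
  exists k : Y -> nat, (\sum_y k y)%N = n /\
    forall S : pred Y, `|\sum_(y | S y) (q y - (k y)%:R)| <= #|Y|%:R / 4.
Proof.
move=> q0 qn; pose fl y := Num.truncn (q y); pose f y := q y - (fl y)%:R.
have f0 y : 0 <= f y by rewrite subr_ge0 truncn_le.
have f1 y : f y <= 1.
  by rewrite lerBlDl natr1 ltW// truncnS_gt.
have sle : (\sum_y fl y <= n)%N.
  by rewrite -(ler_nat R) -qn natr_sum ler_sum// => y _; rewrite truncn_le.
set e := (n - \sum_y fl y)%N.
have sf : \sum_y f y = e%:R.
  by rewrite sumrB qn -natr_sum natrB.
have eY : (e <= #|Y|)%N.
  rewrite -(ler_nat R) -sf -sum1_card natr_sum; exact: ler_sum.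
have [U [Ue Uf]] := exists_top_set f eY.
pose Fo := \sum_(y in ~: U) f y; pose Fi := \sum_(y in U) f y.
have FE : Fi + Fo = e%:R.
  rewrite -sf (bigID (mem U))/=; congr (_ + _).
  by apply: eq_bigl => y; rewrite inE.
have cUC : #|~: U| = (#|Y| - e)%N by rewrite cardsCs finset.setCK Ue.
(* Every part rounded up dominates every part rounded down; sum [f v <= f u] over all such pairs. *)
have FoE : Fo * e%:R <= Fi * (#|Y| - e)%:R.
  have -> : Fo * e%:R = \sum_(u in U) \sum_(v in ~: U) f v.
    by rewrite sumr_const Ue mulr_natr.
  have -> : Fi * (#|Y| - e)%:R = \sum_(u in U) \sum_(v in ~: U) f u.
    by rewrite mulr_suml; apply: eq_bigr => u _; rewrite sumr_const cUC mulr_natr.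
  apply: ler_sum => u uU; apply: ler_sum => v; rewrite inE => vU; exact: Uf.
have Fo0 : 0 <= Fo by apply: sumr_ge0.
have Fob : Fo <= #|Y|%:R / 4.
  rewrite (natrB _ eY) in FoE.
  have [Y0|Y0] := posnP #|Y|.
    move: eY FE FoE; rewrite Y0 leqn0 => /eqP ->.
    have : 0 <= Fi by apply: sumr_ge0.
    by move=> ? ? _; lra.
  have Y0' : 0 < #|Y|%:R :> R by rewrite ltr0n.
  have FiE : Fi = e%:R - Fo by lra.
  have h : Fo * #|Y|%:R <= e%:R * (#|Y|%:R - e%:R) by rewrite FiE in FoE; lra.
  rewrite -(ler_pM2r Y0'); apply: (le_trans h).
  have := sqr_ge0 (#|Y|%:R - 2 * e%:R : R); nra.
exists (fun y => fl y + (y \in U))%N; split.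
  rewrite big_split /= -[RHS](subnKC sle) -/e; congr addn.
  by rewrite -Ue -sum1_card [RHS]big_mkcond; apply: eq_bigr => y _; case: (y \in U).
move=> S.
have -> : \sum_(y | S y) (q y - (fl y + (y \in U))%:R) =
    \sum_(y | S y && (y \notin U)) f y - \sum_(y | S y && (y \in U)) (1 - f y).
  rewrite (bigID (mem U))/= addrC; congr (_ + _).
    by apply: eq_bigr => y /andP[_ /negbTE ->]; rewrite addn0.
  rewrite -sumrN; apply: eq_bigr => y /andP[_ ->]; rewrite natrD /= /f; ring.
have A0 : 0 <= \sum_(y | S y && (y \notin U)) f y by apply: sumr_ge0.
have B0 : 0 <= \sum_(y | S y && (y \in U)) (1 - f y).
  by apply: sumr_ge0 => y _; rewrite subr_ge0.
have A1 : \sum_(y | S y && (y \notin U)) f y <= Fo.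
  rewrite /Fo big_mkcond [leRHS]big_mkcond; apply: ler_sum => y _.
  by rewrite inE; case: (S y); case: (y \in U) => //=.
(* Rounding preserves the total, so the mass gained on [U] equals the mass [Fo] lost outside [U].
   The error on [S] is thus a difference of two numbers in [[0, Fo]]. *)
have B1 : \sum_(y | S y && (y \in U)) (1 - f y) <= Fo.
  have -> : Fo = \sum_(y in U) (1 - f y).
    by rewrite sumrB sumr_const Ue -[Fo](addKr Fi) FE addrC.
  rewrite big_mkcond [leRHS]big_mkcond; apply: ler_sum => y _.
  by case: (S y); case: (y \in U) => //=; rewrite subr_ge0.
rewrite ler_norml; apply/andP; split; lra.
Qed.

(** Listing the values along the enumeration of [Y] gives a composition of [n] into [|Y|] parts,
    which [card_ord_partitions] counts; [YE] provides the successor form required there. *)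
Lemma card_compositions_le (Y : finType) (n : nat) : (0 < #|Y|)%N ->
  (#|[set f : {ffun Y -> 'I_n.+1} | (\sum_y f y)%N == n]%SET| <= 'C(#|Y|.-1 + n, #|Y|.-1))%N.
Proof.
move=> Y0; have YE : #|Y| = #|Y|.-1.+1 by rewrite prednK.
rewrite -card_ord_partitions.
pose F (f : {ffun Y -> 'I_n.+1}) := tcast YE (fgraph f).
have Finj : injective F.
  move=> f g /(congr1 (@tval _ _)); rewrite /F !val_tcast => h.
  by apply: (can_inj (@fgraphK _ _)); apply: val_inj.
rewrite -(card_imset _ Finj); apply/subset_leq_card/fintype.subsetP => _ /imsetP[f + ->].
rewrite !inE /F => /eqP fn; apply/eqP; rewrite -[RHS]fn.
have -> : (\sum_(i <- tcast YE (fgraph f)) i = \sum_(i <- tval (fgraph f)) i)%N.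
  by rewrite val_tcast.
by rewrite -codom_ffun /codom /image_mem big_map big_enum.
Qed.

(** By [pow_le_fact] it suffices that [N + n <= (N+1)/(3r)]. Since [N + n] is at most
    [(N+1)(1/(4r) + 1)], this amounts to [1 <= (1/3 - 1/4)/r], whence the threshold [1/12]. *)
Lemma bin_le_pow (N n : nat) (r : R) : 0 < r -> r <= 12^-1 ->
  n%:R <= N.+1%:R / (4 * r) + 1 -> 'C(N + n, N)%:R <= (r^-1) ^+ N.
Proof.
move=> r0 r12 nr.
have F0 : 0 < N`!%:R :> R by rewrite ltr0n fact_gt0.
rewrite -(ler_pM2r F0) -natrM bin_ffact.
apply: (@le_trans _ _ ((N + n)%:R ^+ N)).
  by rewrite -natrX ler_nat ffact_le_expn.
apply: (@le_trans _ _ ((r^-1 * (N.+1%:R / 3)) ^+ N)); last first.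
  by rewrite exprMn ler_wpM2l ?pow_le_fact// exprn_ge0// invr_ge0 ltW.
rewrite lerXn2r ?nnegrE ?mulr_ge0 ?invr_ge0 ?(ltW r0)//.
rewrite natrD; have -> : N%:R = N.+1%:R - 1 :> R by rewrite -natr1 addrK.
set m := N.+1%:R in nr *; have m0 : 0 <= m by rewrite /m.
suff : m / (4 * r) + m <= r^-1 * (m / 3) by move: nr; lra.
have -> : m / (4 * r) = r^-1 * (m / 4) by rewrite invfM; ring.
have h : 12 <= r^-1 by rewrite -[leLHS]invrK lef_pV2 ?posrE ?invr_gt0.
nra.
Qed.

End rounding.

(** * Match probabilities and the distance between distributions *)

Section match_prob.
Context {R : realType} {Y : pointedFinType} {dX : measure_display}
  {X : measurableType dX} (rho : X -> Y -> R) (D : R).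
Implicit Types (Q : dist R Y) (x : X).

Lemma match_prob_ge0 x Q : 0 <= match_prob rho D x Q.
Proof. by rewrite /match_prob sumr_ge0// => y _; exact: Defs.pmf_ge0. Qed.

Lemma match_prob_le1 x Q : match_prob rho D x Q <= 1.
Proof.
rewrite -(Defs.pmf_sum1 Q) /match_prob [leLHS]big_mkcond; apply: ler_sum => y _.
by case: ifP => // _; exact: Defs.pmf_ge0.
Qed.

Lemma floored_match_prob (eta : R) x Q : (exists y, rho x y <= D) ->
  floored eta Q -> eta <= match_prob rho D x Q.
Proof.
move=> [y xy] Qeta; rewrite /match_prob (bigD1 y)//=.
apply: (le_trans (Qeta y)); rewrite lerDl.
by apply: sumr_ge0 => z _; exact: Defs.pmf_ge0.
Qed.

(** Both signs come from [ln (v/u) <= (v - u)/u], with a denominator that is at least [eta] in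
    either case. *)
Lemma norm_ln_ratio_le (eta e p q : R) : 0 < eta -> eta <= p -> eta <= q ->
  `|p - q| <= eta * e -> `|ln (p / q)| <= e.
Proof.
move=> eta0 etap etaq pq.
have p0 : 0 < p by exact: lt_le_trans etap.
have q0 : 0 < q by exact: lt_le_trans etaq.
have e0 : 0 <= e by rewrite -(pmulr_rge0 _ eta0); exact: le_trans pq.
have aux u v : 0 < v -> eta <= u -> 0 < u -> `|v - u| <= eta * e -> ln (v / u) <= e.
  move=> v0 etau u0 uv; have vu : 0 < v / u by rewrite divr_gt0.
  have := le_ln1Dx (x := v / u - 1); rewrite [1 + _]addrC subrK => h.
  apply: (le_trans (h _)); first by lra.
  have -> : v / u - 1 = (v - u) / u by rewrite mulrBl divff// gt_eqF.
  rewrite ler_pdivrMr//; move: uv; rewrite ler_norml => /andP[_ uv].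
  by apply: (le_trans uv); rewrite mulrC ler_wpM2l.
rewrite ler_norml aux// andbT lerNl -lnV ?posrE ?divr_gt0// invf_div.
by rewrite aux// distrC.
Qed.

Lemma net_dist_le (e : R) Q1 Q2 :
  (forall x, `|ln (match_prob rho D x Q1 / match_prob rho D x Q2)| <= e) ->
  net_dist rho D Q1 Q2 <= e.
Proof.
move=> h; apply: ge_sup; first by exists (`|ln (match_prob rho D point Q1 / match_prob rho D point Q2)|), point.
by move=> _ [x _ <-].
Qed.

(** A supremum dominates its members once the set is bounded: [|p - q| <= 1 = eta * eta^-1] makes
    [eta^-1] an upper bound. *)
Lemma le_net_dist (eta : R) Q1 Q2 x : 0 < eta ->
  (forall x, eta <= match_prob rho D x Q1) ->
  (forall x, eta <= match_prob rho D x Q2) ->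
  `|ln (match_prob rho D x Q1 / match_prob rho D x Q2)| <= net_dist rho D Q1 Q2.
Proof.
move=> eta0 h1 h2; apply: ub_le_sup; last by exists x.
exists eta^-1 => _ [z _ <-]; apply: (@norm_ln_ratio_le eta) => //.
rewrite divff ?gt_eqF//.
have := match_prob_le1 z Q1; have := match_prob_le1 z Q2.
have := match_prob_ge0 z Q1; have := match_prob_ge0 z Q2.
by rewrite ler_norml => *; apply/andP; split; lra.
Qed.

Lemma max_ball_ge1 : (forall x, exists y, rho x y <= D) -> 1 <= max_ball rho D.
Proof.
move=> h; have [y xy] := h point.
apply: (@le_trans _ _ (\sum_(y : Y) (nat_of_bool (rho point y <= D))%:R)).
  by rewrite (bigD1 y)//= xy lerDl; apply: sumr_ge0.
apply: ub_le_sup; last by exists point.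
exists #|Y|%:R => _ [z _ <-]; rewrite -sum1_card natr_sum; apply: ler_sum => i _.
by case: (rho z i <= D); rewrite ?lexx ?ler01.
Qed.

End match_prob.

(** * Grid nets of the prescribed size *)

Section net.
Context {R : realType} {Y : pointedFinType}.

Lemma card_gt0_pointed : (0 < #|Y|)%N.
Proof. by apply/card_gt0P; exists point. Qed.

Section grid.
Variables (eta : R) (eta0 : 0 <= eta) (meta : #|Y|%:R * eta <= 1).

(** The floor is granted to every letter and only the remaining mass is put on the grid, so that
    grid distributions are floored too. *)
Let grid_pmf n (f : {ffun Y -> 'I_n.+1}) (y : Y) : R :=
  eta + (1 - #|Y|%:R * eta) * ((f y : nat)%:R / n%:R).

Definition grid n : {set {ffun Y -> 'I_n.+1}} :=
  [set f : {ffun Y -> 'I_n.+1} | (\sum_y f y)%N == n]%SET.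

Let grid_pmf_ge0 n f y : 0 <= @grid_pmf n f y.
Proof. by rewrite addr_ge0// mulr_ge0 ?subr_ge0// divr_ge0. Qed.

Let grid_pmf_sum1 n (f : {ffun Y -> 'I_n.+1}) : (0 < n)%N -> f \in grid n ->
  \sum_y grid_pmf f y = 1.
Proof.
move=> n0; rewrite inE => /eqP fn; rewrite big_split/= sumr_const -mulr_sumr.
rewrite -mulr_suml -natr_sum fn divff; last by rewrite pnatr_eq0 -lt0n.
rewrite mulr1 -[eta *+ _]mulr_natl; ring.
Qed.

Definition grid_dist n (f : {ffun Y -> 'I_n.+1}) (n0 : (0 < n)%N)
  (fn : f \in grid n) := Dist (grid_pmf_ge0 f) (grid_pmf_sum1 n0 fn).

Lemma grid_dist_floored n f n0 fn : floored eta (@grid_dist n f n0 fn).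
Proof. by move=> y; rewrite lerDl mulr_ge0 ?subr_ge0// divr_ge0. Qed.

Lemma grid_cover n (n0 : (0 < n)%N) (Q : dist R Y) : floored eta Q ->
  exists f, exists fn : f \in grid n,
  forall S : pred Y, `|\sum_(y | S y) (Q y - grid_dist n0 fn y)| <= #|Y|%:R / (4 * n%:R).
Proof.
move=> Qeta.
have nR0 : 0 < n%:R :> R by rewrite ltr0n.
set c := 1 - #|Y|%:R * eta; have c0 : 0 <= c by rewrite subr_ge0.
have c1 : c <= 1 by rewrite gerBl mulr_ge0.
have [q [q0 q1 qE]] : exists q : Y -> R,
    [/\ forall y, 0 <= q y, \sum_y q y = 1 & forall y, Q y = eta + c * q y].
  have sQ : \sum_y (Q y - eta) = c.
    by rewrite sumrB Defs.pmf_sum1 sumr_const -[eta *+ _]mulr_natl.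
  have Qe y : 0 <= Q y - eta by rewrite subr_ge0.
  (* If [c = 0], every [Q y] equals [eta] and any distribution can serve as [q]. *)
  have [cE|cN] := eqVneq c 0.
    exists Q; split; [exact: Defs.pmf_ge0|exact: Defs.pmf_sum1|move=> y].
    rewrite cE mul0r addr0; apply/eqP; rewrite -subr_eq0; apply/eqP.
    by apply: (psumr_eq0P (P := xpredT) (fun z _ => Qe z)) => //; rewrite sQ.
  exists (fun y => (Q y - eta) / c); split => [y||y].
  - by rewrite divr_ge0.
  - by rewrite -mulr_suml sQ divff.
  - by rewrite mulrC divfK// addrC subrK.
have [k [kn kq]] := @largest_remainder R Y (fun y => q y * n%:R) n
   (fun y => mulr_ge0 (q0 y) (ltW nR0)) (etrans (esym (mulr_suml _ _ _ _)) (etrans (congr1 ( *%R^~ n%:R) q1) (mul1r _))).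
have kle y : (k y <= n)%N by rewrite -kn (bigD1 y)//= leq_addr.
pose f := [ffun y => inord (k y) : 'I_n.+1].
have fE y : f y = k y :> nat by rewrite ffunE inordK ?ltnS.
have fn : f \in grid n.
  by rewrite inE -[X in _ == X]kn; apply/eqP/eq_bigr => y _.
exists f, fn => S.
have -> : \sum_(y | S y) (Q y - grid_dist n0 fn y) =
    c / n%:R * \sum_(y | S y) (q y * n%:R - (k y)%:R).
  rewrite mulr_sumr; apply: eq_bigr => y _.
  rewrite /= /grid_pmf fE -/c qE; field.
  by rewrite gt_eqF.
rewrite normrM ger0_norm ?divr_ge0//.
have -> : #|Y|%:R / (4 * n%:R) = n%:R^-1 * (#|Y|%:R / 4) :> R.
  by field; rewrite gt_eqF.
apply: ler_pM; rewrite ?divr_ge0 ?kq//.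
by rewrite ler_pdivrMr// mulVf ?gt_eqF.
Qed.

End grid.

(** A family smaller than the prescribed size is padded by repetition: past the end of the
    enumeration, [nth] returns [i0]. *)
Lemma net_used_intro (eta eps : R) dX (X : measurableType dX) (rho : X -> Y -> R) (D : R)
    (I : finType) (F : I -> dist R Y) :
  (forall x, exists y, rho x y <= D) ->
  (forall i, floored eta (F i)) ->
  (forall Q, floored eta Q -> exists i, net_dist rho D Q (F i) <= eps) ->
  (0 < #|I|)%N -> #|I|%:R <= net_size rho D eta eps ->
  exists k (Q : 'I_k -> dist R Y), net_used rho D eta eps Q.
Proof.
move=> rhoD Feta Fnet I0 Isize.
have c0 : 0 <= Num.ceil (net_size rho D eta eps).
  rewrite -(ler0z R); apply: le_trans (ceil_ge _); exact: le_trans Isize.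
have Ik : (#|I| <= `|Num.ceil (net_size rho D eta eps)|)%N.
  rewrite -(ler_nat R) natr_absz ger0_norm//; exact: le_trans (ceil_ge _).
have [i0 _] : exists i0 : I, true by case/card_gt0P: I0 => i0 _; exists i0.
exists `|Num.ceil (net_size rho D eta eps)|%N, (fun a => F (nth i0 (enum I) a)); split.
- move=> Q /Fnet[i iQ].
  have ik : (enum_rank i < `|Num.ceil (net_size rho D eta eps)|)%N.
    exact: leq_trans Ik.
  exists (Ordinal ik) => /=.
  by have -> : nth i0 (enum I) (enum_rank i) = i by rewrite nth_enum_rank.
- by move=> a x; exact: floored_match_prob.
- by rewrite gez0_abs.
Qed.

(** In terms of [r = eta * eps / sqrt M] the size is [r^-1] to the power [|Y| - 1], and
    [r <= eta * eps] because [M >= 1]. A grid accurate to [r] fits into this size if [r <= 1/12]. If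
    [r = 1] the size is one, and any floored distribution alone is a net, since probabilities differ
    by at most [1 <= eta * eps]. *)
Lemma net_exists (eta eps : R) dX (X : measurableType dX) (rho : X -> Y -> R) (D : R) :
  (forall x, exists y, rho x y <= D) -> 0 < eta < 1 -> @floored R Y eta !=set0 ->
  0 < eps -> (eta * eps / Num.sqrt (max_ball rho D) <= 12^-1) \/
    (1 = eta * eps / Num.sqrt (max_ball rho D)) ->
  exists k (Q : 'I_k -> dist R Y), net_used rho D eta eps Q.
Proof.
move=> rhoD /andP[eta0 eta1] [Q0 Q0eta] eps0.
set M := max_ball rho D; set r := eta * eps / Num.sqrt M.
have M1 : 1 <= Num.sqrt M by rewrite -sqrtr1 ler_wsqrtr// max_ball_ge1.
have M0 : 0 < Num.sqrt M by exact: lt_le_trans M1.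
have r0 : 0 < r by rewrite divr_gt0// mulr_gt0.
have rE : eta * eps = r * Num.sqrt M by rewrite /r divfK// gt_eqF.
have re : r <= eta * eps by rewrite rE ler_pMr.
have nsE : net_size rho D eta eps = r^-1 ^+ #|Y|.-1.
  by rewrite /net_size /r invf_div mulrC.
have cover Q1 Q2 : floored eta Q1 -> floored eta Q2 ->
    (forall S : pred Y, `|\sum_(y | S y) (Q1 y - Q2 y)| <= eta * eps) ->
    net_dist rho D Q1 Q2 <= eps.
  move=> h1 h2 h; apply: net_dist_le => x; apply: (@norm_ln_ratio_le _ eta) => //.
  - exact: floored_match_prob.
  - exact: floored_match_prob.
  - by rewrite -sumrB; exact: h.
have meta : #|Y|%:R * eta <= 1.
  rewrite -[leRHS](Defs.pmf_sum1 Q0) -sum1_card natr_sum mulr_suml; apply: ler_sum => y _.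
  by rewrite mul1r; exact: Q0eta.
case=> [r12|r1]; last first.
  apply: (@net_used_intro eta eps dX X rho D unit (fun=> Q0)) => //.
  - move=> Q Qeta; exists tt; apply: net_dist_le => x.
    apply: (@norm_ln_ratio_le _ eta) => //; try exact: floored_match_prob.
    apply: (@le_trans _ _ 1); last by rewrite r1.
    have := match_prob_le1 rho D x Q; have := match_prob_le1 rho D x Q0.
    have := match_prob_ge0 rho D x Q; have := match_prob_ge0 rho D x Q0.
    by rewrite ler_norml => *; apply/andP; split; lra.
  - by rewrite card_unit.
  - by rewrite card_unit nsE -r1 invr1 expr1n.
have m0 : 0 < #|Y|%:R :> R by rewrite ltr0n card_gt0_pointed.
(* For [n >= z] the rounding error [|Y|/(4n)] is at most [r]. *)
pose z : R := #|Y|%:R / (4 * r).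
have z0 : 0 < z by rewrite divr_gt0// mulr_gt0.
pose n := `|Num.ceil z|%N.
have nE : n%:R = (Num.ceil z)%:~R :> R.
  by rewrite natr_absz ger0_norm// -(ler0z R); exact: le_trans (ltW z0) (ceil_ge _).
have zn : z <= n%:R by rewrite nE ceil_ge.
have nz : n%:R <= z + 1.
  by rewrite nE -lerBlDr; have := ceilB1_lt z; rewrite intrB => /ltW.
have nR0 : 0 < n%:R :> R by exact: lt_le_trans zn.
have n0 : (0 < n)%N by rewrite -(ltr0n R).
pose F (f : {f | f \in grid n}) := grid_dist (ltW eta0) meta n0 (valP f).
apply: (@net_used_intro eta eps dX X rho D _ F) => //.
- by move=> f; exact: grid_dist_floored.
- move=> Q Qeta; have [f [fn fQ]] := grid_cover (ltW eta0) meta n0 Qeta.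
  exists (exist _ f fn); apply: cover => //; first exact: grid_dist_floored.
  move=> S; have := fQ S; rewrite (bool_irrelevance fn (valP (exist _ f fn))) => /le_trans; apply.
  apply: le_trans re; rewrite ler_pdivrMr ?mulr_gt0//.
  have -> : r * (4 * n%:R) = n%:R * (4 * r) by ring.
  by rewrite -ler_pdivrMr; [exact: zn|exact: mulr_gt0].
- have [f [fn _]] := grid_cover (ltW eta0) meta n0 Q0eta.
  by apply/card_gt0P; exists (exist _ f fn).
rewrite card_sig nsE.
apply: le_trans (bin_le_pow r0 r12 (n := n) _); last first.
  by rewrite prednK ?card_gt0_pointed.
rewrite ler_nat; apply: leq_trans (card_compositions_le _ card_gt0_pointed).
by apply: subset_leq_card; apply/fintype.subsetP => f; rewrite !inE.
Qed.

End net.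

(** * Mean cost *)

Section log_geometric.
Import numFieldNormedType.Exports.
Context {R : realType}.
Implicit Types (p q x : R) (N j : nat).

(** The sum is the truncated series of [- ln x] around 1. *)
Lemma is_derive_log_partial_sum N x :
  is_derive x 1 (fun x => \sum_(j < N) (1 - x) ^+ j.+1 / j.+1%:R)
    (- \sum_(j < N) (1 - x) ^+ j).
Proof.
elim: N => [|N IH].
  rewrite big_ord0 oppr0 [X in is_derive _ _ X _](_ : _ = cst 0).
    exact: is_derive_cst.
  by apply/funext => y; rewrite big_ord0.
rewrite [X in is_derive _ _ X _](_ : _ =
  (fun x => \sum_(j < N) (1 - x) ^+ j.+1 / j.+1%:R) +
  (N.+1%:R^-1 \*: ((cst 1 - id : R -> R) ^+ N.+1))); last first.
  apply/funext => y; rewrite big_ord_recr /= !fctE; congr (_ + _).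
  by rewrite mulrC; congr (_ * _); rewrite -[RHS]/(((cst 1 - id : R -> R) ^+ N.+1) y) fctE.
apply: is_derive_eq.
rewrite big_ord_recr/= opprD; congr (_ + _).
rewrite !fctE sub0r /GRing.scale/= mulrN1 mulrN mulKf//.
Qed.

(* sum_j (1 - x)^j.+1 / j.+1 + ln x has derivative (1 - x)^N / x >= 0. *)
Lemma log_partial_sum_le N p q : 0 < p -> p <= q -> q <= 1 ->
  \sum_(j < N) ((1 - p) ^+ j.+1 - (1 - q) ^+ j.+1) / j.+1%:R <= ln (q / p).
Proof.
move=> p0 pq q1; have q0 : 0 < q by exact: lt_le_trans pq.
pose f x := \sum_(j < N) (1 - x) ^+ j.+1 / j.+1%:R + ln x.
have df x : 0 < x -> is_derive x 1 f (- \sum_(j < N) (1 - x) ^+ j + x^-1).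
  by move=> x0; apply: is_deriveD; [exact: is_derive_log_partial_sum|exact: is_derive1_ln].
have cf : {within `[p, q], continuous f}.
  apply: derivable_within_continuous => x; rewrite in_itv/= => /andP[px _].
  by have [] := df x (lt_le_trans p0 px).
have := @MVT_segment R f _ p q pq _ cf.
move=> /(_ (fun x => - \sum_(j < N) (1 - x) ^+ j + x^-1)).
case=> [x|c].
  by rewrite in_itv/= => /andP[px _]; apply: df; exact: lt_trans px.
rewrite in_itv/= => /andP[pc cq] fE.
have c0 : 0 < c by exact: lt_le_trans pc.
have : 0 <= f q - f p.
  rewrite fE mulr_ge0 ?subr_ge0//.
  have h : (1 - (1 - c)) * (\sum_(j < N) (1 - c) ^+ j) = 1 - (1 - c) ^+ N.
    have := subrXX 1 (1 - c) N; rewrite expr1n => ->; congr (_ * _).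
    by apply: eq_bigr => i _; rewrite expr1n mul1r.
  rewrite subKr in h; rewrite addrC subr_ge0 -(ler_pM2l c0) h divff ?gt_eqF//.
  by rewrite gerBl exprn_ge0// subr_ge0 (le_trans cq).
rewrite /f lnM ?posrE ?invr_gt0// lnV ?posrE//.
have -> : \sum_(j < N) ((1 - p) ^+ j.+1 - (1 - q) ^+ j.+1) / j.+1%:R =
    \sum_(j < N) (1 - p) ^+ j.+1 / j.+1%:R - \sum_(j < N) (1 - q) ^+ j.+1 / j.+1%:R.
  by rewrite -sumrB; apply: eq_bigr => j _; rewrite mulrBl.
lra.
Qed.

(** The increment of [log J] from [J = j+1] to [J = j+2], incurred once the codewords of indices 0
    to [j] have all failed. *)
Definition log_step j : R := ln (j.+2%:R / j.+1%:R).

Lemma log_step_ge0 j : 0 <= log_step j.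
Proof. by rewrite ln_ge0// ler_pdivlMr// mul1r ler_nat. Qed.

Lemma log_step_le j : log_step j <= j.+1%:R^-1.
Proof.
have -> : log_step j = ln (1 + j.+1%:R^-1).
  by rewrite /log_step -[j.+2%:R]natr1 mulrDl divff ?mul1r// pnatr_eq0.
by apply: le_ln1Dx; rewrite (@lt_le_trans _ _ 0)// invr_ge0.
Qed.

Lemma sum_log_step N : \sum_(j < N) log_step j = ln N.+1%:R.
Proof.
elim: N => [|N IH]; first by rewrite big_ord0 ln1.
by rewrite big_ord_recr/= IH /log_step -lnM ?posrE ?divr_gt0// mulrC divfK// pnatr_eq0.
Qed.

(** For [q <= p] the terms compare directly; otherwise the weights are replaced by [1/(j+1)].
    Working with partial sums postpones all limits to the integrated statement. *)
Lemma geometric_log_sum_le N p q e : 0 < p -> 0 < q -> p <= 1 -> q <= 1 ->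
  `|ln (p / q)| <= e ->
  \sum_(j < N) log_step j * (1 - p) ^+ j.+1 <=
  \sum_(j < N) log_step j * (1 - q) ^+ j.+1 + e.
Proof.
move=> p0 q0 p1 q1 pqe; have e0 : 0 <= e by exact: le_trans pqe.
have [qp|pq] := leP q p.
  rewrite -[leLHS]addr0 lerD// ler_sum// => j _; rewrite ler_wpM2l ?log_step_ge0//.
  by rewrite lerXn2r ?nnegrE ?subr_ge0// lerD2l lerN2.
rewrite -lerBlDl -sumrB; apply: (@le_trans _ _ (ln (q / p))); last first.
  apply: le_trans pqe; rewrite -[p / q]invf_div lnV ?posrE ?divr_gt0// normrN.
  exact: ler_norm.
apply: le_trans (log_partial_sum_le N p0 (ltW pq) q1).
apply: ler_sum => j _; rewrite -mulrBr mulrC ler_wpM2l ?log_step_le//.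
by rewrite subr_ge0 lerXn2r ?nnegrE ?subr_ge0// lerD2l lerN2 ltW.
Qed.

End log_geometric.

(** * The cost as a series over unmatched codewords *)

Section mean_cost.
Context {R : realType} {Y : pointedFinType} {dX : measure_display}
  {X : measurableType dX} (rho : X -> Y -> R) (D : R).
Hypothesis mrho : forall y, measurable_fun setT (rho ^~ y).
Implicit Types (Q : dist R Y) (x : X) (C : codebook Y) (n j : nat).

(** The event [J > n]. As a set of pairs it gives joint measurability of the cost, and its sections
    give the law of [J] for a fixed [x]. *)
Definition unmatched n : set (X * codebook Y) :=
  [set z | forall i, (i < n)%N -> D < rho z.1 (z.2 i)].

Lemma measurable_codeword i (y : Y) : measurable [set C : codebook Y | C i = y].
Proof. by apply: sub_sigma_algebra; exists i, y. Qed.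

Lemma measurable_unmatched n : measurable (unmatched n).
Proof.
have -> : unmatched n = \bigcap_(i in `I_n) \bigcup_(y in [set: Y])
    ([set x | D < rho x y] `*` [set C : codebook Y | C i = y]).
  apply/seteqP; split=> [[x C] /= h i /h xC|[x C] /= h i /h [y _ [/= xy Cy]]].
    by exists (C i).
  by rewrite Cy.
apply: bigcap_measurableType => i _.
  apply: fin_bigcup_measurable => [|y _]; first exact: finite_finset.
  apply: measurableX; last exact: measurable_codeword.
  have -> : [set x | D < rho x y] = setT `&` (rho ^~ y) @^-1` `]D, +oo[.
    by rewrite setTI; apply/seteqP; split=> x /=; rewrite in_itv/= andbT.
  exact: mrho.
Qed.

(** [log J] is the sum of its increments up to [J]. If nothing matches, the partial sums [ln (n+1)]
    are unbounded and both sides are infinite. *)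
Lemma costE x C : cost rho D x C =
  (\sum_(j <oo) (log_step j)%:E * (\1_(unmatched j.+1) (x, C) : R)%:E)%E.
Proof.
have t0 j : (0 <= (log_step j : R)%:E * (\1_(unmatched j.+1) (x, C))%:E)%E.
  by rewrite mule_ge0// lee_fin ?log_step_ge0.
have sumE n : unmatched n (x, C) ->
    (\sum_(0 <= j < n) (log_step j)%:E * (\1_(unmatched j.+1) (x, C) : R)%:E)%E
    = (ln n.+1%:R : R)%:E.
  move=> nu; rewrite big_mkord -sum_log_step -sumEFin; apply: eq_bigr => j _.
  rewrite indicE mem_set ?mule1// => i ij; apply: nu; exact: leq_trans (ltn_ord j).
have [[j0 [j0D j0min]]|none] := pselect (exists j0, rho x (C j0) <= D /\
    forall i, (i < j0)%N -> D < rho x (C i)).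
  have -> : cost rho D x C = (ln j0.+1%:R)%:E.
    rewrite /cost -lne_EFin//; congr lne; apply/eqP; rewrite eq_le.
    apply/andP; split; first by apply: ereal_inf_lbound; exists j0.
    apply: le_ereal_inf_tmp => _ [j /= jD <-]; rewrite lee_fin ler_nat ltnS leqNgt.
    by apply/negP => /j0min; rewrite ltNge jD.
  rewrite (@nneseries_split _ _ 0 j0)// add0n sumE; last exact: j0min.
  rewrite eseries0 ?adde0// => j j0j _; rewrite indicE memNset ?mule0//.
  by move=> /(_ j0); rewrite /= ltnS => /(_ j0j); rewrite ltNge j0D.
have all i : D < rho x (C i).
  have [i' i'i] := ubnP i; elim: i' i i'i => // i' IH i; rewrite ltnS => ii'.
  rewrite ltNge; apply/negP => iD; apply: none; exists i; split => // k ki.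
  by apply: IH; exact: leq_trans ii'.
have -> : cost rho D x C = +oo%E.
  rewrite /cost /first_match (_ : [set _ | _ in _] = set0) ?ereal_inf0//.
  by rewrite -subset0 => r [j /=]; rewrite leNgt all.
apply/esym/eqyP => r _; pose n := (Num.truncn (expR r)).+1.
apply: le_trans (nneseries_lim_ge n (fun j _ _ => t0 j)).
rewrite sumE; last by move=> i _; exact: all.
rewrite lee_fin -[leLHS]expRK ler_ln ?posrE ?expR_gt0//.
by apply: (le_trans (ltW (truncnS_gt _))); rewrite ler_nat.
Qed.

Lemma cost_ge0 x C : (0 <= cost rho D x C)%E.
Proof.
by rewrite costE nneseries_ge0// => j _ _; rewrite mule_ge0// lee_fin ?log_step_ge0.
Qed.

Lemma measurable_cost :
  measurable_fun setT (fun z : X * codebook Y => cost rho D z.1 z.2).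
Proof.
have -> : (fun z : X * codebook Y => cost rho D z.1 z.2) = (fun z =>
  \sum_(0 <= j <oo | j \in xpredT) (log_step j)%:E * (\1_(unmatched j.+1) z : R)%:E)%E.
  by apply/funext => -[x C]; rewrite costE; apply: eq_eseriesl.
apply: ge0_emeasurable_sum => [j z _ _|j _].
  by rewrite mule_ge0// lee_fin ?log_step_ge0.
apply: measurable_funeM; apply/measurable_EFinP.
by apply: measurable_indic; exact: measurable_unmatched.
Qed.

(** The section is a finite disjoint union of cylinders, one per word of [n] non-matching letters;
    distributivity turns the sum of products into a power. *)
Lemma codebook_law_unmatched x Q n :
  codebook_law Q (xsection (unmatched n) x) = ((1 - match_prob rho D x Q) ^+ n)%:E.
Proof.
pose cyl (w : {ffun 'I_n -> Y}) : set (codebook Y) :=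
  [set C | forall i : 'I_n, C i = w i].
have cylE w : codebook_law Q (cyl w) = (\prod_(i < n) Q (w i))%:E.
  (* [iid_codewords] expects an infinite word, so [w] is continued by [point]. *)
  have := codebook_lawP Q n (fun i => odflt point (omap w (insub i))) => h.
  transitivity (codebook_law Q [set C | forall j, (j < n)%N ->
      C j = odflt point (omap w (insub j))]).
    congr (_ _); apply/seteqP; split => C h' i.
      by move=> ni; rewrite -/(nat_of_ord (Ordinal ni)) valK /= -h'.
    by rewrite h'// valK.
  by rewrite h; congr EFin; apply: eq_bigr => i _; rewrite valK.
pose W := [set w : {ffun 'I_n -> Y} | w \in ffun_on [pred y | D < rho x y]].
have -> : xsection (unmatched n) x = \bigcup_(w in W) cyl w.
  apply/seteqP; split => C; rewrite /xsection /= inE.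
    move=> h; exists [ffun i : 'I_n => C i].
      by apply/ffun_onP => i; rewrite ffunE inE; exact: h.
    by move=> i; rewrite ffunE.
  move=> [w /= /ffun_onP wW Cw] i ni.
  by have /= -> := Cw (Ordinal ni); exact: (wW (Ordinal ni)).
rewrite measure_fin_bigcup; last 3 first.
- exact: finite_finset.
- by move=> w v _ _ [C [/= Cw Cv]]; apply/ffunP => i; rewrite -Cw -Cv.
- move=> w _.
  have -> : cyl w = \bigcap_(i in [set: 'I_n]) [set C | C i = w i].
    by apply/seteqP; split => [C Cw i _|C Cw i]; [exact: Cw|exact: Cw].
  by apply: fin_bigcap_measurable => [|i _]; [exact: finite_finset|exact: measurable_codeword].
rewrite -(@bigfs _ _ _ _ (index_enum {ffun 'I_n -> Y})
  (fun w => w \in ffun_on [pred y | D < rho x y])) ?index_enum_uniq//; last first.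
  by move=> w _; rewrite mem_index_enum.
rewrite (eq_bigr _ (fun w _ => cylE w)) sumEFin; congr EFin.
rewrite -(bigA_distr_big _ (fun (i : 'I_n) y => Q y)) prodr_const card_ord; congr (_ ^+ _).
suff -> : 1 = match_prob rho D x Q + \sum_(y | D < rho x y) Q y by rewrite addrC addKr.
rewrite -[LHS](Defs.pmf_sum1 Q) (bigID (fun y => rho x y <= D))/=; congr (_ + _).
by apply: eq_bigl => y; rewrite ltNge.
Qed.

Lemma integral_cost x Q : (\int[codebook_law Q]_C cost rho D x C =
  \sum_(j <oo) (log_step j * (1 - match_prob rho D x Q) ^+ j.+1)%:E)%E.
Proof.
have mx j : measurable (xsection (unmatched j) x).
  by apply: measurable_xsection; exact: measurable_unmatched.
under eq_integral do rewrite costE.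
rewrite integral_nneseries//; last 2 first.
- move=> j; apply: measurable_funeM; apply/measurable_EFinP.
  have -> : (fun C => \1_(unmatched j.+1) (x, C) : R) = \1_(xsection (unmatched j.+1) x).
    by apply/funext => C; rewrite !indicE mem_xsection.
  exact: measurable_indic.
- by move=> j C _; rewrite mule_ge0// lee_fin ?log_step_ge0.
apply: eq_eseriesr => j _.
rewrite EFinM -codebook_law_unmatched.
rewrite -(setIT (xsection _ _)) -integral_indic// -ge0_integralZl//.
- by apply: eq_integral => C _; rewrite !indicE mem_xsection.
- by apply/measurable_EFinP; exact: measurable_indic.
- by rewrite lee_fin log_step_ge0.
Qed.

Section with_source.
Variable PX : probability X R.

Lemma mean_costE Q :
  mean_cost rho D PX Q = (\int[PX]_x \int[codebook_law Q]_C cost rho D x C)%E.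
Proof.
rewrite /mean_cost fubini_tonelli1//; first exact: measurable_cost.
by move=> z; exact: cost_ge0.
Qed.

Lemma mean_cost_ge0 Q : (0 <= mean_cost rho D PX Q)%E.
Proof. by apply: integral_ge0 => z _; exact: cost_ge0. Qed.

Let measurable_integral_cost Q :
  measurable_fun setT (fun x => \int[codebook_law Q]_C cost rho D x C)%E.
Proof.
apply: (measurable_fun_fubini_tonelli_F (fun z : X * codebook Y => cost rho D z.1 z.2)).
  exact: measurable_cost.
by move=> z; exact: cost_ge0.
Qed.

Let series_le (u v : nat -> R) (e : R) : (forall j, 0 <= u j) -> (forall j, 0 <= v j) ->
  (forall N, \sum_(j < N) u j <= \sum_(j < N) v j + e) ->
  (\sum_(j <oo) (u j)%:E <= \sum_(j <oo) (v j)%:E + e%:E)%E.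
Proof.
move=> u0 v0 uv; apply: lime_le.
  by apply: is_cvg_nneseries => j _ _; rewrite lee_fin.
near=> N; rewrite sumEFin big_mkord.
apply: (@le_trans _ _ (\sum_(j < N) v j + e)%:E); first by rewrite lee_fin.
rewrite EFinD leeD2r// -(big_mkord xpredT v) -sumEFin.
by apply: nneseries_lim_ge => j _ _; rewrite lee_fin.
Unshelve. all: by end_near. Qed.

Lemma mean_cost_lipschitz (eta e : R) Q1 Q2 : 0 < eta ->
  (forall x, eta <= match_prob rho D x Q1) ->
  (forall x, eta <= match_prob rho D x Q2) ->
  net_dist rho D Q2 Q1 <= e ->
  (mean_cost rho D PX Q1 <= mean_cost rho D PX Q2 + e%:E)%E.
Proof.
move=> eta0 h1 h2 Q21.
have e0 : 0 <= e.
  exact: (le_trans (normr_ge0 _) (le_trans (le_net_dist point eta0 h2 h1) Q21)).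
have cost_int0 Q x : (0 <= \int[codebook_law Q]_C cost rho D x C)%E.
  by apply: integral_ge0 => C _; exact: cost_ge0.
rewrite !mean_costE.
have -> : e%:E = (\int[PX]_x (cst e%:E x))%E.
  by rewrite integral_cst//= probability_setT mule1.
rewrite -ge0_integralD//.
apply: ge0_le_integral => //.
  exact: emeasurable_funD.
move=> x _; rewrite !integral_cost.
have p1 := match_prob_le1 rho D x Q1; have p2 := match_prob_le1 rho D x Q2.
apply: series_le => [j|j|N].
- by rewrite mulr_ge0 ?log_step_ge0 ?exprn_ge0 ?subr_ge0.
- by rewrite mulr_ge0 ?log_step_ge0 ?exprn_ge0 ?subr_ge0.
have p10 := lt_le_trans eta0 (h1 x); have p20 := lt_le_trans eta0 (h2 x).
apply: geometric_log_sum_le => //; rewrite -invf_div lnV ?posrE ?divr_gt0// normrN.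
exact: le_trans (le_net_dist x eta0 h2 h1) Q21.
Qed.

(** Comparison with match probability 1, for which the cost vanishes; the logarithmic distance to it
    is at most [- ln eta]. *)
Lemma mean_cost_le (eta : R) Q : 0 < eta ->
  (forall x, eta <= match_prob rho D x Q) ->
  (mean_cost rho D PX Q <= (- ln eta)%:E)%E.
Proof.
move=> eta0 h; rewrite mean_costE.
have -> : (- ln eta)%:E = (\int[PX]_x (cst (- ln eta)%:E x))%E.
  by rewrite integral_cst//= probability_setT mule1.
have eta1 : eta <= 1 by exact: le_trans (h point) (match_prob_le1 _ _ _ _).
apply: ge0_le_integral => //.
- by move=> x _; apply: integral_ge0 => C _; exact: cost_ge0.
move=> x _; rewrite integral_cost.
have p1 := match_prob_le1 rho D x Q.
have p0 : 0 < match_prob rho D x Q by exact: lt_le_trans (h x).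
apply: (@le_trans _ _ (\sum_(j <oo) 0%:E + (- ln eta)%:E)%E); last by rewrite eseries0// add0e.
apply: series_le => // [j|N].
  by rewrite mulr_ge0 ?log_step_ge0 ?exprn_ge0 ?subr_ge0.
apply: le_trans (geometric_log_sum_le (e := - ln eta) N p0 ltr01 p1 (lexx 1) _) _.
  by rewrite divr1 ler0_norm ?ln_le0// lerN2 ler_ln ?posrE.
rewrite lerD2r; apply: ler_sum => j _.
by rewrite subrr expr0n mulr0.
Qed.

End with_source.

End mean_cost.

(** * Concentration along the plays of an arm *)

Section tape.
Context {R : realType}.

(** Independence is asked of the first [L] coordinates, so iterated binary products suffice; each
    new factor supplies one coordinate. *)
Lemma iid_tape_exists dS (S : measurableType dS) (nu : probability S R) (L : nat) :
  exists (dW : measure_display) (W : measurableType dW) (PW : probability W R)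
    (z : nat -> W -> S),
  (forall l, measurable_fun setT (z l)) /\
  forall B : nat -> set S, (forall l, measurable (B l)) ->
    PW [set w | forall l, (l < L)%N -> B l (z l w)] = (\prod_(l < L) nu (B l))%E.
Proof.
elim: L => [|L [dW [W [PW [z [mz zB]]]]]].
  exists dS, S, nu, (fun=> id); split => [l|B mB]; first exact: measurable_id.
  rewrite big_ord0 -(probability_setT nu); congr (_ _).
  by apply/seteqP; split.
exists _, (W * S)%type, (PW \x nu)%E, (fun l p => if l == L then p.2 else z l p.1).
split=> [l|B mB].
  by case: (l == L); [exact: measurable_snd|exact: measurableT_comp].
have mE : measurable [set w | forall l, (l < L)%N -> B l (z l w)].
  have -> : [set w | forall l, (l < L)%N -> B l (z l w)] = \bigcap_(l in `I_L) (z l @^-1` B l).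
    by apply/seteqP; split.
  by apply: bigcap_measurableType => l _; rewrite -[X in measurable X]setTI; exact: mz.
rewrite big_ord_recr/= -zB// -product_measure1E//; congr (_ _).
apply/seteqP; split=> [[w s]/= h|[w s]/= [h BLs] l].
  split=> [l lL|].
    by have := h l (ltnW lL); rewrite (ltn_eqF lL).
  by have := h L (ltnSn L); rewrite eqxx.
rewrite ltnS leq_eqVlt; case: eqVneq => [->//|_ /= lL]; exact: h.
Qed.

Section resampling.
Context {dO : measure_display} {Omega : measurableType dO} (P : probability Omega R)
  {dS : measure_display} {S : measurableType dS} (nu : probability S R)
  (Z : nat -> Omega -> S) (pl : nat -> Omega -> bool) (L : nat).
Hypothesis mZ : forall t, measurable_fun setT (Z t).
Hypothesis mpl : forall t, measurable [set w | pl t w].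

Definition observed t w := [seq Z s w | s <- index_iota 1 t & pl s w].

Definition observed_in (B : nat -> set S) t i : set Omega :=
  [set w | size (observed t w) = i /\
    forall l, (l < i)%N -> B l (nth point (observed t w) l)].

Lemma observedS t w : (0 < t)%N ->
  observed t.+1 w = observed t w ++ (if pl t w then [:: Z t w] else [::]).
Proof.
move=> t0; rewrite /observed /index_iota subSS subn0.
have -> : iota 1 t = iota 1 (t - 1) ++ [:: t].
  by rewrite -[t in LHS](subnK t0) iotaD/= subnKC.
by rewrite filter_cat map_cat /=; case: ifP.
Qed.

Lemma size_observed t w : (size (observed t w) <= t.-1)%N.
Proof.
by rewrite size_map size_filter (leq_trans (count_size _ _))// size_iota subn1.
Qed.

(** Splitting on whether round [t] is a play gives the recursion behind measurability, membership in
    the history and the product formula. *)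
Lemma observed_inS B t i : (0 < t)%N -> observed_in B t.+1 i =
  (observed_in B t i `&` [set w | ~~ pl t w]) `|`
  (if i is i'.+1 then observed_in B t i' `&` [set w | pl t w] `&` Z t @^-1` B i' else set0).
Proof.
move=> t0; apply/seteqP; split=> w; rewrite /observed_in /= observedS//.
  case: ifP => [plt|plt]; last by rewrite cats0; left.
  rewrite size_cat addn1 => -[<- /= h]; right; split.
    split=> //; split=> // l ls; have := h l (ltnW ls).
    by rewrite nth_cat ls.
  by have := h _ (ltnSn _); rewrite nth_cat ltnn subnn.
case=> [[[<- h] /negbTE ->]|].
  by rewrite cats0.
case: i => [//|i] /= [[[<- h] plt] Zt]; rewrite plt size_cat addn1; split=> // l.
rewrite ltnS leq_eqVlt nth_cat => /predU1P[->|ls]; first by rewrite ltnn subnn.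
by rewrite ls; exact: h.
Qed.

Lemma observed_in1 B i : observed_in B 1 i = if i is 0 then setT else set0.
Proof.
apply/seteqP; split=> w; rewrite /observed_in /observed /index_iota subnn /=.
  by case: i => // i [].
by case: i.
Qed.

Lemma observed_in_set0 B t i : (t <= i)%N -> (0 < t)%N -> observed_in B t i = set0.
Proof.
move=> ti t0; rewrite -subset0 => w [si _].
by have := size_observed t w; rewrite si leqNgt prednK// ti.
Qed.

Lemma measurable_observed_in B t i : (forall l, measurable (B l)) -> (0 < t)%N ->
  measurable (observed_in B t i).
Proof.
move=> mB; case: t => // t _; elim: t i => [|t IH] i.
  by rewrite observed_in1; case: i.
rewrite observed_inS//; apply: measurableU.
  apply: measurableI => //.
  have -> : [set w | ~~ pl t.+1 w] = ~` [set w | pl t.+1 w].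
    by apply/seteqP; split=> w /negP.
  exact: measurableC.
case: i => // i; apply: measurableI; first exact: measurableI.
by rewrite -[X in measurable X]setTI; exact: mZ.
Qed.

(** A property of one family [B], because a run provides independence from the past on rectangles
    [U x V]. *)
Definition fresh (B : nat -> set S) := forall t i, (0 < t)%N ->
  P (observed_in B t i `&` [set w | pl t w] `&` Z t @^-1` B i) =
  (P (observed_in B t i `&` [set w | pl t w]) * nu (B i))%E.

(* The i-th term is the probability that exactly i plays happened before time t,
   all with outcome in B, times the probability that the L - i replacement draws
   fall in B; one more fresh play leaves the sum unchanged. *)
Lemma sum_observed_in B t : (forall l, measurable (B l)) -> fresh B ->
  (0 < t)%N -> (t <= L.+1)%N ->
  (\sum_(i < L.+1) P (observed_in B t i) * \prod_(i <= l < L) nu (B l) =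
   \prod_(l < L) nu (B l))%E.
Proof.
move=> mB fB; case: t => // t _; elim: t => [|t IH] tL.
  rewrite big_ord_recl [X in (_ + X)%E]big1 => [|i _]; last by rewrite observed_in1/= measure0 mul0e.
  by rewrite observed_in1 probability_setT mul1e adde0 big_mkord.
have g0 i : (0 <= \prod_(i <= l < L) nu (B l))%E by apply: prode_ge0.
have mpl' : measurable [set w | ~~ pl t.+1 w].
  have -> : [set w | ~~ pl t.+1 w] = ~` [set w | pl t.+1 w].
    by apply/seteqP; split=> w /negP.
  exact: measurableC.
have mF i := measurable_observed_in i mB (ltn0Sn t).
rewrite -[RHS]IH ?(ltnW tL)//.
pose a i := (P (observed_in B t.+1 i `&` [set w | ~~ pl t.+1 w]) *
  \prod_(i <= l < L) nu (B l))%E.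
pose b i := (P (observed_in B t.+1 i `&` [set w | pl t.+1 w]) *
  \prod_(i <= l < L) nu (B l))%E.
have -> : (\sum_(i < L.+1) P (observed_in B t.+1 i) * \prod_(i <= l < L) nu (B l) =
    \sum_(i < L.+1) a i + \sum_(i < L.+1) b i)%E.
  rewrite -big_split/=; apply: eq_bigr => i _.
  rewrite /a /b -ge0_muleDl// -measureU//; last 3 first.
  - exact: measurableI.
  - exact: measurableI.
  - by rewrite -subset0 => w /= [[_ /negP]] np [_].
  congr (P _ * _)%E; apply/seteqP; split=> w /=.
    by case: (pl t.+1 w); [right|left].
  by case=> -[].
(* A play moves mass from count [i] to [i.+1], and freshness turns its outcome into the factor
   [nu (B i)]; so [b'] is [b] shifted by one. *)
pose b' i := (if i is i'.+1 then b i' else 0)%E.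
have -> : (\sum_(i < L.+1) P (observed_in B t.+2 i) * \prod_(i <= l < L) nu (B l) =
    \sum_(i < L.+1) a i + \sum_(i < L.+1) b' i)%E.
  rewrite -big_split/=; apply: eq_bigr => -[i iL] _ /=.
  rewrite observed_inS// measureU//; last 3 first.
  - exact: measurableI.
  - case: i iL => // i _; apply: measurableI; first exact: measurableI.
    by rewrite -[X in measurable X]setTI; exact: mZ.
  - rewrite -subset0 => w /= [[_ /negP np]]; case: i {iL} => //= i [[_ pt] _]; exact: np.
  rewrite ge0_muleDl//; congr (_ + _)%E; case: i iL => [|i] iL; first by rewrite measure0 mul0e.
  by rewrite /b' /b [in RHS]big_ltn// muleA; congr (_ * _)%E; exact: fB.
(* The shift drops the term [b L], which is null: fewer than [L] plays can precede round [t.+1]. *)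
congr (_ + _)%E; rewrite big_ord_recl/= add0e big_ord_recr/= [X in (_ + X)%E](_ : _ = 0%E) ?adde0//.
by rewrite /b observed_in_set0 ?set0I ?measure0 ?mul0e.
Qed.

(** The tape reads the observed outcomes and then continues with draws from the auxiliary factor
    [W]. Partitioning by the number of plays before [t] yields the sum computed in
    [sum_observed_in]. *)
Lemma resampled_tape t : (0 < t)%N -> (t <= L.+1)%N ->
  exists (dW : measure_display) (W : measurableType dW) (PW : probability W R)
    (zeta : nat -> Omega * W -> S),
  [/\ forall l, measurable_fun setT (zeta l),
      forall l w w', (l < size (observed t w))%N ->
        zeta l (w, w') = nth point (observed t w) l &
      forall B, (forall l, measurable (B l)) -> fresh B ->
        (P \x PW)%E [set p | forall l, (l < L)%N -> B l (zeta l p)] =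
        (\prod_(l < L) nu (B l))%E].
Proof.
move=> t0 tL; have [dW [W [PW [z [mz zB]]]]] := iid_tape_exists nu L.
pose zeta t l (p : Omega * W) :=
  if (l < size (observed t p.1))%N then nth point (observed t p.1) l else z l p.2.
exists dW, W, PW, (zeta t); split=> [l|l w w' ls|B mB fB]; last 1 first.
- have mFz i : measurable [set w' | forall l, (i <= l < L)%N -> B l (z l w')].
    have -> : [set w' | forall l, (i <= l < L)%N -> B l (z l w')] =
        \bigcap_(l in [set l | (i <= l < L)%N]) (z l @^-1` B l).
      by apply/seteqP; split.
    by apply: bigcap_measurableType => l _; rewrite -[X in measurable X]setTI; exact: mz.
  have zE i : (i <= L)%N -> PW [set w' | forall l, (i <= l < L)%N -> B l (z l w')] =
      (\prod_(i <= l < L) nu (B l))%E.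
    move=> iL; pose B' l := if (i <= l)%N then B l else setT.
    have mB' l : measurable (B' l) by rewrite /B'; case: ifP.
    transitivity (PW [set w' | forall l, (l < L)%N -> B' l (z l w')]).
      congr (PW _); apply/seteqP; split=> w' h l.
        by move=> lL; rewrite /B'; case: ifP => // il; apply: h; rewrite il.
      by move=> /andP[il lL]; have := h l lL; rewrite /B' il.
    rewrite zB// -(big_mkord xpredT (fun l => nu (B' l))) (@big_cat_nat _ _ _ i)//=.
    rewrite big_nat big1 ?mul1e => [|l /andP[_ li]]; last first.
      by rewrite /B' leqNgt li/= probability_setT.
    by rewrite !big_nat; apply: eq_bigr => l /andP[il _]; rewrite /B' il.
  have -> : [set p | forall l, (l < L)%N -> B l (zeta t l p)] =
      \bigcup_(i in `I_L.+1) (observed_in B t i `*`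
        [set w' | forall l, (i <= l < L)%N -> B l (z l w')]).
    apply/seteqP; split=> [[w w'] /= h|[w w'] /= [i iL [/= [si hi] h]] l lL].
      have sL : (size (observed t w) < L.+1)%N.
        by rewrite (leq_ltn_trans (size_observed _ _))// prednK.
      exists (size (observed t w)) => //; split; [split=> // l ls|move=> l /= /andP[sl lL]].
        have lL : (l < L)%N by rewrite (leq_trans ls).
        by have := h l lL; rewrite /zeta/= ls.
      by have := h l lL; rewrite /zeta/= ltnNge sl.
    rewrite /zeta /= si; case: ltnP => il; first exact: hi.
    by apply: h; rewrite il.
  rewrite measure_fin_bigcup//; last 2 first.
  + move=> i j _ _ [[w w'] /= [[[si _] _] [[sj _] _]]]; by rewrite -si -sj.
  + by move=> i _; apply: measurableX => //; exact: measurable_observed_in.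
  rewrite -fsbig_ord -(sum_observed_in (t := t))//; apply: eq_bigr => i _.
  apply: etrans; first by apply: product_measure1E => //; exact: measurable_observed_in.
  by rewrite /= zE// -ltnS.
- case: t t0 {tL} => // t _; elim: t => [|t IH].
    rewrite [X in measurable_fun _ X](_ : _ = z l \o snd); last first.
      by apply/funext => p; rewrite /zeta /observed /index_iota subnn.
    exact: measurableT_comp.
  (* One more round changes entry [l] exactly when it is a play preceded by [l] plays. *)
  rewrite [X in measurable_fun _ X](_ : _ = fun p =>
    if pl t.+1 p.1 && (size (observed t.+1 p.1) == l) then Z t.+1 p.1 else zeta t.+1 l p); last first.
    apply/funext => p; rewrite /zeta observedS//; case: (pl t.+1 p.1); last by rewrite cats0.
    rewrite size_cat addn1 ltnS nth_cat /=.
    by case: (ltngtP l (size _)) => // ->; rewrite subnn.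
  apply: measurable_fun_ifT => //; last exact: measurableT_comp.
  apply: (@measurable_fun_bool _ _ _ _ true).
  rewrite setTI [X in measurable X](_ : _ =
    ([set w | pl t.+1 w] `&` observed_in (fun=> setT) t.+1 l) `*` setT); last first.
    apply/seteqP; split=> p /=; first by move=> /andP[-> /eqP].
    by move=> [[-> [/eqP -> _]] _].
  apply: measurableX => //; apply: measurableI => //.
  exact: measurable_observed_in.
- by rewrite /zeta /= ls.
Qed.

End resampling.
End tape.

(** Continuity from above along the thresholds [r + 1/(j+1)]. *)
Lemma probability_le_right_cont (R : realType) d (T : measurableType d) (P : probability T R)
    (f : T -> \bar R) (r : R) (p : \bar R) : measurable_fun setT f ->
  (forall r', r < r' -> (p <= P [set w | (f w <= r'%:E)%E])%E) ->
  (p <= P [set w | (f w <= r%:E)%E])%E.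
Proof.
move=> mf h.
have mF r' : measurable [set w | (f w <= r'%:E)%E].
  by rewrite -[X in measurable X]setTI; exact: emeasurable_fun_infty_c.
pose F j := [set w | (f w <= (r + j.+1%:R^-1)%:E)%E].
have FE : [set w | (f w <= r%:E)%E] = \bigcap_j F j.
  apply/seteqP; split=> w /= => [fr j _|fF].
    by rewrite /F /= (le_trans fr)// lee_fin lerDl invr_ge0.
  apply/lee_addgt0Pr => e e0.
  have := fF (Num.truncn e^-1) I; rewrite /F /= => /le_trans; apply.
  rewrite -EFinD lee_fin lerD2l -[leRHS]invrK lef_pV2 ?posrE ?invr_gt0//.
  exact: ltW (truncnS_gt _).
have nF : nonincreasing_seq F.
  move=> i j ij; apply/subsetPset => w /= /le_trans; apply.
  by rewrite lee_fin lerD2l lef_pV2 ?posrE// ler_nat.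
have cF : P \o F @ \oo --> P [set w | (f w <= r%:E)%E].
  rewrite FE; apply: nonincreasing_cvg_mu nF => [|i|].
  - exact: le_lt_trans (probability_le1 _ (mF _)) (ltry 1).
  - exact: mF.
  - by rewrite -FE; exact: mF.
have <- : limn (P \o F) = P [set w | (f w <= r%:E)%E] by exact/cvg_lim.
apply: lime_ge; first by apply/cvg_ex; eexists; exact: cF.
by apply: nearW => j; apply: h; rewrite ltrDl invr_gt0.
Qed.

(** * The confidence bound for adaptively collected costs *)

Section confidence.
Context {R : realType} {Y : pointedFinType} {dX : measure_display}
  {X : measurableType dX} (rho : X -> Y -> R) (D : R).
Hypothesis mrho : forall y, measurable_fun setT (rho ^~ y).
Variables (PX : probability X R) (c eta : R).
Hypotheses (cc : confidence_constant c) (eta01 : 0 < eta < 1).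

Lemma measurable_cost_comp dO (Omega : measurableType dO) (x : Omega -> X)
    (C : Omega -> codebook Y) : measurable_fun setT x -> measurable_fun setT C ->
  measurable_fun setT (fun w => cost rho D (x w) (C w)).
Proof.
move=> mx mC.
have := measurableT_comp (measurable_cost D mrho) (measurable_fun_pair mx mC).
exact.
Qed.

(* confidence_constant needs eta < match_prob: it is applied with all smaller
   values of eta, and r |-> P (f <= r) is right-continuous. *)
Lemma confidence_bound_ge (Q : dist R Y) n delta :
  (forall x, eta <= match_prob rho D x Q) -> (0 < n)%N -> 0 < delta <= 2^-1 ->
  confidence_bound rho D PX c eta Q n delta.
Proof.
move=> Qeta n0 /andP[d0 d2] dO Omega P Xs Cs XC.
have [c0 cb] := cc; have /andP[eta0 eta1] := eta01.
apply: probability_le_right_cont => [|r' rr'].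
  apply: measurableT_comp => //; apply: emeasurable_funB => //.
  apply: measurable_funeM; apply: emeasurable_sum => i.
  by apply: measurable_cost_comp; exact: measurable_funPT.
have s0 : 0 < Num.sqrt (n%:R^-1 * ln delta^-1).
  rewrite sqrtr_gt0 mulr_gt0 ?invr_gt0 ?ltr0n// ln_gt0// invf_gt1//; lra.
set s := Num.sqrt _ in s0.
have r0 : 0 < r' by apply: lt_trans rr'; rewrite mulr_gt0// divr_gt0.
(* The value whose radius is exactly [r']; it lies below [eta] because [r'] exceeds the radius of
   [eta]. *)
pose eta' := c * s / r'.
have eta'0 : 0 < eta' by rewrite divr_gt0// mulr_gt0.
have eta'1 : eta' < eta.
  move: rr'; rewrite /conf_radius -/s /eta' ltr_pdivrMr// mulrC mulrA.
  by rewrite ltr_pdivrMr// [s * c]mulrC [r' * _]mulrC.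
have -> : r' = conf_radius c eta' n delta.
  by rewrite /conf_radius -/s /eta'; field; rewrite !gt_eqF.
apply: (cb) => //.
- by rewrite eta'0 (lt_trans eta'1).
- by move=> x; exact: lt_le_trans (Qeta x).
- by rewrite d0.
Qed.

Section deviation.
Variables (k : nat) (Q : 'I_k -> dist R Y) (alpha : R).
Context {dO : measure_display} {Omega : measurableType dO} {P : probability Omega R}
  (A : nat -> Omega -> 'I_k) (Xs : nat -> {RV P >-> X})
  (Cs : nat -> {RV P >-> codebook Y}).
Hypothesis run : lcb_run rho D Q A Xs Cs PX alpha c eta.
Hypothesis Qeta : forall a x, eta <= match_prob rho D x (Q a).
Variable a : 'I_k.

Let Z t w := (Xs t w, Cs t w).
Let pl t w := A t w == a.

Let nu : probability (X * codebook Y)%type R := (PX \x codebook_law (Q a))%E.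

Let nuE U V : measurable U -> measurable V -> nu (U `*` V) = (PX U * codebook_law (Q a) V)%E.
Proof. by move=> mU mV; exact: product_measure1E. Qed.

Let mZ t : measurable_fun setT (Z t).
Proof. by apply: measurable_fun_pair; exact: measurable_funPT. Qed.

Let plE t : [set w | pl t w] = A t @^-1` [set a].
Proof. by apply/seteqP; split=> w /= /eqP. Qed.

Let mpl t : measurable [set w | pl t w].
Proof. by rewrite plE; exact: arm_measurable run t a. Qed.

Lemma arm_costsE t w :
  arm_costs rho D A Xs Cs t a w = [seq cost rho D s.1 s.2 | s <- observed Z pl t w].
Proof. by rewrite /arm_costs /observed -map_comp. Qed.

(** The induction runs on [s] inside the fixed history of round [t], where the events of all rounds
    before [s <= t] are generators. *)
Lemma history_observed_in (U : nat -> set X) (V : nat -> set (codebook Y)) t s i :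
  (forall l, measurable (U l)) -> (forall l, measurable (V l)) ->
  (0 < s <= t)%N -> history A Xs Cs t (observed_in Z pl (fun l => U l `*` V l) s i).
Proof.
move=> mU mV; pose B l := U l `*` V l; rewrite /history; set G := (X in <<s X >>).
elim: s i => [//|[_|s IH]] i /= st.
  rewrite observed_in1; case: i => [|_].
    exact: (@measurableT _ (g_sigma_algebraType G)).
  exact: (@measurable0 _ (g_sigma_algebraType G)).
have h i' : (@measurable _ (g_sigma_algebraType G)) (observed_in Z pl B s.+1 i').
  by apply: IH; exact: ltnW.
have hA : (@measurable _ (g_sigma_algebraType G)) [set w | pl s.+1 w].
  apply: sub_sigma_algebra; left; exists s.+1, a; split; last exact: plE.
  exact: ltnW.
have hZ i' : (@measurable _ (g_sigma_algebraType G)) (Z s.+1 @^-1` B i').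
  rewrite (_ : _ @^-1` _ = (Xs s.+1 @^-1` U i') `&` (Cs s.+1 @^-1` V i'))//.
  apply: (@measurableI _ (g_sigma_algebraType G)); apply: sub_sigma_algebra; right.
    by left; exists s.+1, (U i').
  by right; exists s.+1, (V i').
rewrite observed_inS//.
apply: (@measurableU _ (g_sigma_algebraType G)).
  apply: (@measurableI _ (g_sigma_algebraType G)) => //.
  have -> : [set w | ~~ pl s.+1 w] = ~` [set w | pl s.+1 w].
    by apply/seteqP; split=> w /negP.
  exact: (@measurableC _ (g_sigma_algebraType G)).
case: i => [|i]; first exact: (@measurable0 _ (g_sigma_algebraType G)).
apply: (@measurableI _ (g_sigma_algebraType G)); last exact: hZ.
by apply: (@measurableI _ (g_sigma_algebraType G)); [exact: h|exact: hA].
Qed.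

Lemma fresh_rectangles (U : nat -> set X) (V : nat -> set (codebook Y)) :
  (forall l, measurable (U l)) -> (forall l, measurable (V l)) ->
  fresh P nu Z pl (fun l => U l `*` V l).
Proof.
move=> mU mV t i t0.
have hF : history A Xs Cs t (observed_in Z pl (fun l => U l `*` V l) t i).
  by apply: history_observed_in => //; rewrite t0 leqnn.
have := fresh_draws run a t0 hF (mU i) (mV i).
rewrite nuE// plE => <-; congr (P _).
by rewrite -[in RHS]setIA.
Qed.

(** Fixing the number of plays inside the event separates the random sample size from the deviation,
    at the price of a union over [n]. *)
Definition deviates t n : set Omega :=
  [set w | size (arm_costs rho D A Xs Cs t a w) = n] `&`
  ~` [set w | (`| (n%:R^-1)%:E * \sum_(b <- arm_costs rho D A Xs Cs t a w) b
          - mean_cost rho D PX (Q a) | <= (conf_radius c eta n (t%:R `^ (- alpha)))%:E)%E].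

Lemma measurable_deviates t n : (0 < t)%N -> measurable (deviates t n).
Proof.
move=> t0; apply: measurableI.
  have -> : [set w | size (arm_costs rho D A Xs Cs t a w) = n] =
      observed_in Z pl (fun=> setT) t n.
    by apply/seteqP; split=> w; rewrite /observed_in/= arm_costsE size_map // => -[].
  exact: measurable_observed_in.
apply: measurableC; rewrite -[X in measurable X]setTI; apply: emeasurable_fun_infty_c => //.
apply: measurableT_comp => //; apply: emeasurable_funB => //; apply: measurable_funeM.
rewrite [X in measurable_fun _ X](_ : _ = fun w =>
  (\sum_(s <- index_iota 1 t) (if A s w == a then cost rho D (Xs s w) (Cs s w) else 0))%E); last first.
  by apply/funext => w; rewrite /arm_costs big_map big_filter big_mkcond.
apply: emeasurable_sum => s; apply: measurable_fun_ifT => //.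
  by apply: (@measurable_fun_bool _ _ _ _ true); rewrite setTI; exact: mpl.
by apply: measurable_cost_comp; exact: measurable_funPT.
Qed.

Lemma deviates_le t n : (0 < n)%N -> (1 < t)%N -> 1 <= alpha ->
  (P (deviates t n) <= (t%:R `^ (- alpha))%:E)%E.
Proof.
move=> n0 t1 alpha1; have t0 := ltnW t1.
set delta := _ `^ _.
have tR0 : 0 < t%:R :> R by rewrite ltr0n.
have d0 : 0 < delta by exact: powR_gt0.
have d2 : delta <= 2^-1.
  rewrite /delta powRN lef_pV2 ?posrE ?powR_gt0//.
  apply: (@le_trans _ _ (t%:R `^ 1)); first by rewrite powRr1// ler_nat.
  by rewrite ler_powR// ler1n.
(* The tape length [n + t] leaves room for the [t - 1] possible plays and for a sample of size
   [n]. *)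
have tL : (t <= (n + t).+1)%N by rewrite leqW// leq_addl.
have [dW [W [PW [zeta [mzeta zobs zB]]]]] :=
  resampled_tape P nu mZ mpl t0 tL.
pose P' : probability (Omega * W)%type R := (P \x PW)%E.
have mX i : measurable_fun setT (fun p => (zeta i p).1) by exact: measurableT_comp.
have mC i : measurable_fun setT (fun p => (zeta i p).2) by exact: measurableT_comp.
pose X' (i : 'I_n) : {RV P' >-> X} := mfun_Sub (mem_set (mX i)).
pose C' (i : 'I_n) : {RV P' >-> codebook Y} := mfun_Sub (mem_set (mC i)).
have := @confidence_bound_ge (Q a) n delta (Qeta a) n0 _ _ _ P' X' C'.
rewrite d0 d2 => /(_ isT).
set good := [set w | _].
have indep : (forall (U : 'I_n -> set X) (V : 'I_n -> set (codebook Y)),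
     (forall i, measurable (U i)) -> (forall i, measurable (V i)) ->
     P' [set w | forall i, U i (X' i w) /\ V i (C' i w)] =
     \prod_(i < n) (PX (U i) * codebook_law (Q a) (V i)))%E.
  move=> U V mU mV.
  (* Entries from [n] on are left free and contribute the factor 1. *)
  pose UU l := if insub l is Some i then U i else setT.
  pose VV l := if insub l is Some i then V i else setT.
  have mUU l : measurable (UU l) by rewrite /UU; case: insub.
  have mVV l : measurable (VV l) by rewrite /VV; case: insub.
  have := zB (fun l => UU l `*` VV l) (fun l => measurableX (mUU l) (mVV l)) (fresh_rectangles mUU mVV).
  rewrite big_split_ord/= [X in (_ * X)%E]big1 => [|i _]; last first.
    rewrite nuE// /UU /VV insubF ?probability_setT ?mule1//.
    by apply/negbTE; rewrite -leqNgt leq_addr.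
  rewrite mule1 => h; transitivity (\prod_(i < n) nu (UU i `*` VV i))%E; last first.
    by apply: eq_bigr => i _; rewrite nuE// /UU /VV valK.
  rewrite -h; congr (_ _); apply/seteqP; split=> p /= hp.
    move=> l _; rewrite /UU /VV; case: insubP => [i _ <-|_] /=; [exact: hp|by []].
  move=> i; have := hp i; rewrite /UU /VV valK; apply.
  by rewrite ltn_addr.
move=> /(_ indep) good_ge.
have mgood : measurable good.
  rewrite -[X in measurable X]setTI; apply: emeasurable_fun_infty_c => //.
  apply: measurableT_comp => //; apply: emeasurable_funB => //.
  apply: measurable_funeM; apply: emeasurable_sum => i.
  by apply: measurable_cost_comp; exact: measurable_funPT.
have -> : P (deviates t n) = P' (deviates t n `*` setT).
  apply/esym; apply: etrans.
    by apply: product_measure1E => //; exact: measurable_deviates.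
  by rewrite /= probability_setT mule1.
(* After exactly [n] plays the first [n] tape entries are the observed outcomes, whatever the
   auxiliary coordinate, so a deviation is a failure of [good]. *)
apply: (@le_trans _ _ (P' (~` good))).
  apply: le_measure; rewrite ?inE.
  - by apply: measurableX => //; exact: measurable_deviates.
  - exact: measurableC.
  move=> [w w'] [[/= sn dev] _] gd; apply: dev; move: gd; rewrite /good /=.
  congr (`|_ * _ - _| <= _)%E.
  rewrite arm_costsE size_map in sn *.
  rewrite big_map (big_nth point) sn big_mkord; apply: eq_bigr => i _.
  by rewrite /= zobs// sn.
rewrite probability_setC// -(@leeD2rE _ (P' good)) ?fin_num_measure//.
rewrite subeK ?fin_num_measure// -leeBlDl//.
Qed.

End deviation.
End confidence.

(** * Regret of the LCB algorithm *)

Section counting.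
Context {R : realType} (k : nat) (A : nat -> 'I_k).

Definition pulls t a := count (fun s => A s == a) (index_iota 1 t).

Lemma pulls1 a : pulls 1 a = 0%N.
Proof. by []. Qed.

Lemma pullsS t a : (0 < t)%N -> pulls t.+1 a = (pulls t a + (A t == a))%N.
Proof.
move=> t0; rewrite /pulls /index_iota subSS subn0.
have -> : iota 1 t = iota 1 (t - 1) ++ [:: t].
  by rewrite -[t in LHS](subnK t0) iotaD/= subnKC.
by rewrite count_cat /= addn0.
Qed.

Lemma sum_pulls T : (\sum_a pulls T.+1 a = T)%N.
Proof.
elim: T => [|T IH]; first by rewrite big1.
under eq_bigr do rewrite pullsS//.
rewrite big_split/= IH (bigD1 (A T.+1))//= eqxx big1 ?addn0 ?addn1// => a.
by rewrite eq_sym => /negbTE ->.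
Qed.

Lemma sum_first_pulls T : (\sum_(1 <= t < T.+1) (pulls t (A t) == 0) <= k)%N.
Proof.
(* The induction needs the sharper count of the arms already played. *)
suff : (\sum_(1 <= t < T.+1) (pulls t (A t) == 0) <= \sum_a (0 < pulls T.+1 a))%N.
  move=> /leq_trans; apply; rewrite -[leqRHS]card_ord -sum1_card.
  by apply: leq_sum => a _; case: (_ < _)%N.
elim: T => [|T IH]; first by rewrite big_geq.
rewrite big_nat_recr//=; apply: (leq_trans (leq_add IH (leqnn _))).
rewrite (bigD1 (A T.+1))//= [leqRHS](bigD1 (A T.+1))//= addnAC leq_add//.
  by rewrite (@pullsS T.+1)// eqxx addn1/=; case: (pulls _ _).
by apply: leq_sum => a _; rewrite (@pullsS T.+1)//; case: (pulls _ _).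
Qed.

(** With [x], [y] the two roots, [(y - x)(y + x) = 1] and [y <= 3x], so [y + x <= 4x]. The
    right-hand side telescopes along the plays of an arm. *)
Lemma inv_sqrt_le n : (0 < n)%N ->
  (Num.sqrt n%:R)^-1 <= 4 * (Num.sqrt n.+1%:R - Num.sqrt n%:R) :> R.
Proof.
move=> n0; set x := Num.sqrt n%:R; set y := Num.sqrt n.+1%:R.
have n1 : 1 <= n%:R :> R by rewrite ler1n.
have x0 : 0 < x by rewrite sqrtr_gt0 ltr0n.
have x2 : x ^+ 2 = n%:R by rewrite sqr_sqrtr.
have y2 : y ^+ 2 = n%:R + 1 by rewrite sqr_sqrtr// natr1.
have y0 : 0 <= y by rewrite sqrtr_ge0.
have y3 : y <= 3 * x.
  rewrite -(@ler_pXn2r _ 2)// ?nnegrE ?mulr_ge0 ?(ltW x0)//.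
  by rewrite y2 exprMn x2; lra.
have xy : (y - x) * (y + x) = 1 by rewrite -subr_sqr x2 y2; ring.
rewrite -[leLHS]mul1r ler_pdivrMr//.
have : (y - x) * (y + x) <= (y - x) * (4 * x).
  apply: ler_wpM2l; last by lra.
  by rewrite subr_ge0 -(@ler_pXn2r _ 2) ?nnegrE ?(ltW x0)// x2 y2; lra.
by rewrite xy; lra.
Qed.

Lemma sum_inv_sqrt_pulls T :
  \sum_(1 <= t < T.+1) (if pulls t (A t) == 0 then 0 else (Num.sqrt (pulls t (A t))%:R)^-1)
  <= 4 * Num.sqrt (k%:R * T%:R) :> R.
Proof.
apply: (@le_trans _ _ (\sum_a 4 * Num.sqrt (pulls T.+1 a)%:R)).
  elim: T => [|T IH].
    by rewrite big_geq//; apply: sumr_ge0 => a _; rewrite mulr_ge0// sqrtr_ge0.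
  rewrite big_nat_recr//=; apply: (le_trans (lerD IH (lexx _))).
  rewrite (bigD1 (A T.+1))//= [leRHS](bigD1 (A T.+1))//= addrAC lerD//.
    rewrite (@pullsS T.+1)// eqxx addn1; case: ifP => [_|/negbT].
      by rewrite addr0 ler_pM2l// ler_wsqrtr// ler_nat.
    by rewrite -lt0n => /inv_sqrt_le; lra.
  apply: ler_sum => a _; rewrite ler_pM2l// ler_wsqrtr// ler_nat (@pullsS T.+1)//.
  exact: leq_addr.
rewrite -mulr_sumr ler_pM2l//.
have k0 : (0 < k)%N := leq_ltn_trans (leq0n _) (ltn_ord (A 0%N)).
have [->|T0] := posnP T.
  by rewrite big1 ?sqrtr_ge0// => a _; rewrite pulls1 sqrtr0.
(* The square root is bounded by its tangent at the even split [T/k], of slope [s/2]; the tangents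
   sum explicitly because the play counts sum to [T]. *)
set s := Num.sqrt (k%:R / T%:R : R).
have kR : 0 < k%:R :> R by rewrite ltr0n.
have TR : 0 < T%:R :> R by rewrite ltr0n.
have s0 : 0 < s by rewrite sqrtr_gt0 divr_gt0.
have s2 : s ^+ 2 = k%:R / T%:R by rewrite sqr_sqrtr// divr_ge0.
have kE : k%:R = s ^+ 2 * T%:R by rewrite s2 divfK ?gt_eqF.
have -> : Num.sqrt (k%:R * T%:R) = s * T%:R.
  have -> : k%:R * T%:R = (s * T%:R) ^+ 2 by rewrite kE; ring.
  by rewrite sqrtr_sqr ger0_norm// mulr_ge0// ltW.
apply: (@le_trans _ _ (\sum_a (s / 2 * (pulls T.+1 a)%:R + (2 * s)^-1))).
  apply: ler_sum => a _; set x := Num.sqrt _.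
  have -> : (pulls T.+1 a)%:R = x ^+ 2 by rewrite sqr_sqrtr.
  have -> : s / 2 * x ^+ 2 + (2 * s)^-1 = x + s / 2 * (x - s^-1) ^+ 2.
    by field; rewrite gt_eqF.
  by rewrite lerDl mulr_ge0 ?sqr_ge0// divr_ge0// ltW.
rewrite big_split/= -mulr_sumr -natr_sum sum_pulls sumr_const card_ord.
rewrite -[_ *+ k]mulr_natl kE.
rewrite [leLHS](_ : _ = s * T%:R)//.
by field; rewrite gt_eqF.
Qed.

Lemma sum_inv_le_ln T : (0 < T)%N -> \sum_(2 <= t < T.+1) t%:R^-1 <= ln T%:R :> R.
Proof.
case: T => // T _; elim: T => [|T IH]; first by rewrite big_geq// ln1.
rewrite big_nat_recr//=; apply: (le_trans (lerD IH (lexx _))).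
rewrite -lerBrDl -[ln T.+2%:R - _]opprB -ln_div ?posrE// lerNr.
have -> : T.+1%:R / T.+2%:R = 1 + - T.+2%:R^-1 :> R.
  by rewrite -[in LHS](addrK 1 T.+1%:R) natr1 mulrBl divff ?mul1r// pnatr_eq0.
apply: le_ln1Dx; rewrite ltrN2 invf_lt1 ?ltr0n// ltr1n.
by [].
Qed.

End counting.

Lemma measurable_fun_arm (R : realType) d (T : measurableType d) k (A : T -> 'I_k)
    (F : 'I_k -> \bar R) : (forall a, measurable (A @^-1` [set a])) ->
  measurable_fun setT (fun w => F (A w)).
Proof.
move=> mA _ U _; rewrite setTI.
have -> : (fun w => F (A w)) @^-1` U = \bigcup_(a in [set a | U (F a)]) (A @^-1` [set a]).
  by apply/seteqP; split=> [w Uw|w [a /= Ua Aw]]; [by exists (A w)|by rewrite /= Aw].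
by apply: fin_bigcup_measurable => //; exact: finite_finset.
Qed.

Lemma ler_sum_seq (R : numDomainType) (I : eqType) (s : seq I) (F : I -> R) i :
  i \in s -> (forall j, 0 <= F j) -> F i <= \sum_(j <- s) F j.
Proof.
move=> + F0; elim: s => [//|j s IH]; rewrite in_cons big_cons => /predU1P[->|/IH h].
  by rewrite lerDl sumr_ge0.
by apply: (le_trans h); rewrite lerDr.
Qed.

(** With means [x], [y] of the chosen and the best arm, empirical means [v], [u] and radii [r], [s]:
    [x <= v + r <= u - s + 2r <= y + 2r]. *)
Lemma lcb_order_gap (R : realFieldType) (x y u v r s : R) :
  x - r <= v -> u <= y + s -> v - r <= u - s -> x - y <= 2 * r.
Proof. lra. Qed.

Lemma abse_sub_leP (R : realType) (u : \bar R) (m r : R) :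
  (`|u - m%:E| <= r%:E)%E -> exists2 v, u = v%:E & `|v - m| <= r.
Proof. by case: u => [v| |]//= h; exists v. Qed.

Lemma conf_radius_le (R : realType) (c eta alpha : R) (n t T : nat) :
  0 <= c -> 0 < eta -> 0 <= alpha -> (0 < n)%N -> (0 < t)%N -> (t <= T)%N ->
  conf_radius c eta n (t%:R `^ (- alpha)) <=
  c / eta * Num.sqrt (alpha * ln T%:R) * (Num.sqrt n%:R)^-1.
Proof.
move=> c0 eta0 alpha0 n0 t0 tT; rewrite /conf_radius -[leRHS]mulrA ler_wpM2l ?divr_ge0 ?(ltW eta0)//.
have T0 : 0 <= alpha * ln T%:R by rewrite mulr_ge0// ln_ge0// ler1n (leq_trans t0).
rewrite -sqrtrV// -(sqrtrM _ T0).
rewrite ler_wsqrtr// mulrC ler_wpM2r ?invr_ge0// -powRN opprK ln_powR ler_wpM2l//.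
by rewrite ler_ln ?posrE ?ltr0n ?ler_nat// (leq_trans t0).
Qed.

(** * Regret against the best arm, then against all floored distributions *)

Section regret.
Context {R : realType} {Y : pointedFinType} {dX : measure_display}
  {X : measurableType dX} (rho : X -> Y -> R) (D : R).
Hypothesis mrho : forall y, measurable_fun setT (rho ^~ y).
Variables (PX : probability X R) (c eta : R).
Hypotheses (cc : confidence_constant c) (eta01 : 0 < eta < 1).
Variables (k : nat) (Q : 'I_k -> dist R Y) (alpha : R) (astar : 'I_k).
Context {dO : measure_display} {Omega : measurableType dO} {P : probability Omega R}
  (A : nat -> Omega -> 'I_k) (Xs : nat -> {RV P >-> X})
  (Cs : nat -> {RV P >-> codebook Y}).
Hypothesis run : lcb_run rho D Q A Xs Cs PX alpha c eta.
Hypothesis Qeta : forall a x, eta <= match_prob rho D x (Q a).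
Hypothesis alpha2 : 2 <= alpha.

Variable b : 'I_k -> R.
Hypothesis mean_costb : forall a, mean_cost rho D PX (Q a) = (b a)%:E.

Let N t w a := pulls (A ^~ w) t a.
Let dev := deviates rho D PX c eta Q alpha A Xs Cs.

Let eta0 : 0 < eta. Proof. by case/andP: eta01. Qed.

Let b_ge0 a : 0 <= b a.
Proof. by rewrite -lee_fin -mean_costb; exact: mean_cost_ge0. Qed.

Let b_le a : b a <= - ln eta.
Proof. by rewrite -lee_fin -mean_costb; exact: mean_cost_le. Qed.

Let size_arm_costs t a w : size (arm_costs rho D A Xs Cs t a w) = N t w a.
Proof. by rewrite size_map size_filter. Qed.

Let ndev_mean t a w : ~ dev a t (N t w a) w ->
  exists2 v, ((N t w a)%:R^-1%:E * (\sum_(b <- arm_costs rho D A Xs Cs t a w) b))%E = v%:E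
  & `|v - b a| <= conf_radius c eta (N t w a) (t%:R `^ (- alpha)).
Proof.
move=> h; apply: abse_sub_leP; rewrite -mean_costb.
by apply: contrapT => h'; apply: h; split.
Qed.

Let lcbE t a w : (0 < N t w a)%N ->
  lcb c eta (arm_costs rho D A Xs Cs t a w) (t%:R `^ (- alpha)) =
  ((N t w a)%:R^-1%:E * (\sum_(b <- arm_costs rho D A Xs Cs t a w) b) -
   (conf_radius c eta (N t w a) (t%:R `^ (- alpha)))%:E)%E.
Proof. by rewrite -size_arm_costs; case: arm_costs. Qed.

Let lcb0 t a w : N t w a = 0%N ->
  lcb c eta (arm_costs rho D A Xs Cs t a w) (t%:R `^ (- alpha)) = -oo%E.
Proof. by rewrite -size_arm_costs => /size0nil ->. Qed.

Lemma gap_le_radius t w : (0 < t)%N -> (0 < N t w (A t w))%N ->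
  (forall a, (0 < N t w a)%N -> ~ dev a t (N t w a) w) ->
  b (A t w) - b astar <= 2 * conf_radius c eta (N t w (A t w)) (t%:R `^ (- alpha)).
Proof.
move=> t0 n0 ndev; have := arm_lcb run astar w t0.
have [v vE] := ndev_mean (ndev _ n0); rewrite lcbE// vE ler_distl => /andP[v1 v2].
(* An unplayed best arm would have index [-oo], below the finite index of the chosen arm. *)
have [s0|s0] := posnP (N t w astar); first by rewrite lcb0.
have [u uE] := ndev_mean (ndev _ s0); rewrite lcbE// uE ler_distl => /andP[u1 u2].
by rewrite -!EFinB lee_fin; exact: lcb_order_gap.
Qed.

Let B := - ln eta.

Let B0 : 0 <= B. Proof. exact: le_trans (b_ge0 astar) (b_le astar). Qed.

Local Notation tau T := (c / eta * Num.sqrt (alpha * ln T%:R)).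

(** All possible sample sizes [n < t] are counted, not the realized one, so that the expectation is
    a plain sum of probabilities. *)
Definition dev_count (T : nat) (w : Omega) : R :=
  \sum_(1 <= t < T.+1) \sum_(a < k) \sum_(1 <= n < t) \1_(dev a t n) w.

Let c0 : 0 < c. Proof. by case: cc. Qed.

Let tau_ge0 T : 0 <= tau T.
Proof. by rewrite mulr_ge0 ?divr_ge0 ?(ltW c0) ?(ltW eta0) ?sqrtr_ge0. Qed.

Let N_lt t w a : (0 < t)%N -> (N t w a < t)%N.
Proof.
move=> t0; rewrite -(prednK t0) ltnS (leq_trans (count_size _ _))//.
by rewrite size_iota subn1 prednK.
Qed.

(** The three terms cover an arm not yet played, a round with all sample means within their radii,
    and a round with some deviation. In the first and last case the gap is bounded by [B]. *)
Lemma pathwise_gap_le T t w : (0 < t)%N -> (t <= T)%N ->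
  b (A t w) - b astar <= B * (N t w (A t w) == 0%N)%:R +
    2 * tau T * (if N t w (A t w) == 0%N then 0 else (Num.sqrt (N t w (A t w))%:R)^-1) +
    B * \sum_(a < k) \sum_(1 <= n < t) \1_(dev a t n) w.
Proof.
move=> t0 tT.
have S0 : 0 <= \sum_(a < k) \sum_(1 <= n < t) (\1_(dev a t n) w : R).
  by apply: sumr_ge0 => a _; apply: sumr_ge0 => n _.
have gapB : b (A t w) - b astar <= B.
  by rewrite lerBlDr (le_trans (b_le _))// lerDl.
have BS := mulr_ge0 B0 S0.
have [NE|N0] := eqVneq (N t w (A t w)) 0%N; first by rewrite mulr1 mulr0 addr0 (le_trans gapB)// lerDl.
rewrite mulr0 add0r; rewrite -lt0n in N0.
have s0 : 0 <= (Num.sqrt (N t w (A t w))%:R)^-1 :> R by rewrite invr_ge0 sqrtr_ge0.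
have [ndev|] := pselect (forall a, (0 < N t w a)%N -> ~ dev a t (N t w a) w).
  apply: (le_trans (gap_le_radius t0 N0 ndev)); rewrite -[leLHS]addr0 lerD// -mulrA ler_pM2l//.
  by apply: conf_radius_le => //; [exact: ltW|exact: le_trans alpha2].
move=> /existsNP[a /not_implyP[Na /contrapT da]].
have S1 : 1 <= \sum_(a < k) \sum_(1 <= n < t) (\1_(dev a t n) w : R).
  have nt : N t w a \in index_iota 1 t by rewrite mem_index_iota Na N_lt.
  apply: le_trans (ler_sum_seq (mem_index_enum a) _); last by move=> a'; exact: sumr_ge0.
  apply: le_trans (ler_sum_seq nt _); last by [].
  by rewrite indicE mem_set.
have h := mulr_ge0 (mulr_ge0 (ler0n R 2) (tau_ge0 T)) s0.
rewrite (le_trans gapB)//; have := ler_wpM2l B0 S1; rewrite mulr1 => /le_trans; apply.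
by rewrite lerDr.
Qed.

Lemma pathwise_regret_le T w :
  \sum_(1 <= t < T.+1) (b (A t w) - b astar) <=
  B * k%:R + 8 * tau T * Num.sqrt (k%:R * T%:R) + B * dev_count T w.
Proof.
apply: (@le_trans _ _ (\sum_(1 <= t < T.+1) (B * (N t w (A t w) == 0%N)%:R +
    2 * tau T * (if N t w (A t w) == 0%N then 0 else (Num.sqrt (N t w (A t w))%:R)^-1) +
    B * \sum_(a < k) \sum_(1 <= n < t) \1_(dev a t n) w))).
  rewrite big_nat [leRHS]big_nat; apply: ler_sum => t /andP[t1 tT].
  exact: pathwise_gap_le.
rewrite !big_split/= -!mulr_sumr lerD// lerD//.
  by rewrite ler_wpM2l// -natr_sum ler_nat; exact: (sum_first_pulls (A ^~ w)).
have := ler_wpM2l (tau_ge0 T) (sum_inv_sqrt_pulls (R := R) (A ^~ w) T).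
by rewrite /N; lra.
Qed.

Lemma measurable_dev_count_round t : measurable_fun setT
  (fun w => \sum_(a < k) \sum_(1 <= n < t) (\1_(dev a t n) w : R)%:E)%E.
Proof.
case: t => [|t].
  rewrite [X in measurable_fun _ X](_ : _ = cst 0%E); first exact: measurable_cst.
  by apply/funext => w; rewrite big1// => a _; rewrite big_geq.
apply: emeasurable_sum => a; apply: emeasurable_sum => n; apply/measurable_EFinP.
by apply: measurable_indic; exact: measurable_deviates.
Qed.

Lemma dev_countE T w : (dev_count T w)%:E =
  (\sum_(1 <= t < T.+1) \sum_(a < k) \sum_(1 <= n < t) (\1_(dev a t n) w : R)%:E)%E.
Proof.
rewrite /dev_count -sumEFin; apply: eq_bigr => t _; rewrite -sumEFin.
by apply: eq_bigr => a _; rewrite -sumEFin.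
Qed.

Lemma measurable_dev_count T : measurable_fun setT (dev_count T).
Proof.
apply/measurable_EFinP; rewrite [X in measurable_fun _ X](_ : _ = fun w => (dev_count T w)%:E)//.
under eq_fun do rewrite dev_countE.
by apply: emeasurable_sum => t; exact: measurable_dev_count_round.
Qed.

(** There are [k] arms and fewer than [t] sample sizes, each of probability at most
    [t^(-alpha) <= t^(-2)]. At [t = 1] the range of sample sizes is empty. *)
Lemma dev_prob_round t : (0 < t)%N ->
  (\int[P]_w (\sum_(a < k) \sum_(1 <= n < t) (\1_(dev a t n) w : R)%:E) <=
   (if (t == 1)%N then 0 else k%:R * t%:R^-1)%:E)%E.
Proof.
move=> t0; have [->|t1] := eqVneq t 1%N.
  by rewrite [leLHS](_ : _ = 0)%E// integral0_eq// => w _; rewrite big1// => a _; rewrite big_geq.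
have {}t1 : (1 < t)%N by rewrite ltn_neqAle eq_sym t1.
have tR : 1 <= t%:R :> R by rewrite ler1n.
have tR0 : 0 < t%:R :> R by exact: lt_le_trans tR.
have mdev a n : measurable (dev a t n) by exact: measurable_deviates.
have mind a n : measurable_fun setT (fun w => (\1_(dev a t n) w : R)%:E).
  by apply/measurable_EFinP; apply: measurable_indic.
rewrite ge0_integral_sum//; last 2 first.
- by move=> a; apply: emeasurable_sum.
- by move=> a w _; apply: sume_ge0 => n _; rewrite lee_fin.
apply: (@le_trans _ _ (\sum_(a < k) \sum_(1 <= n < t) (t%:R `^ (- alpha) : R)%:E)%E).
  apply: lee_sum => a _; rewrite ge0_integral_sum//.
  rewrite big_nat [leRHS]big_nat; apply: lee_sum => n /andP[n1 nt].
  rewrite integral_indic// setIT; apply: deviates_le => //.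
  by rewrite (le_trans _ alpha2)// ler1n.
under eq_bigr do rewrite sumEFin.
rewrite sumEFin lee_fin big_const_nat iter_addr_0 sumr_const card_ord.
rewrite -[leLHS]mulr_natl ler_wpM2l// -[leLHS]mulr_natl.
have pw : t%:R `^ (- alpha) <= (t%:R ^+ 2)^-1 :> R.
  rewrite powRN lef_pV2 ?posrE ?powR_gt0 ?exprn_gt0//.
  by rewrite -powR_mulrn ?(ltW tR0)// ler_powR.
apply: (@le_trans _ _ (t%:R * (t%:R ^+ 2)^-1)).
  by apply: ler_pM => //; rewrite ?powR_ge0 ?ler_nat ?leq_subr.
by rewrite expr2 invfM mulrA divff ?gt_eqF// mul1r.
Qed.

Lemma expected_dev_count T : (0 < T)%N ->
  (\int[P]_w (dev_count T w)%:E <= (k%:R * ln T%:R)%:E)%E.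
Proof.
move=> T0; under eq_integral do rewrite dev_countE.
rewrite ge0_integral_sum//; last 2 first.
- exact: measurable_dev_count_round.
- by move=> t w _; apply: sume_ge0 => a _; apply: sume_ge0 => n _; rewrite lee_fin.
apply: (@le_trans _ _ (\sum_(1 <= t < T.+1) (if (t == 1)%N then 0 else k%:R * t%:R^-1 : R)%:E)%E).
  by rewrite big_nat [leRHS]big_nat; apply: lee_sum => t /andP[t1 _]; exact: dev_prob_round.
rewrite sumEFin lee_fin big_ltn// eqxx add0r.
apply: le_trans (ler_wpM2l (ler0n R k) (sum_inv_le_ln T0)).
rewrite mulr_sumr big_nat [leRHS]big_nat; apply: ler_sum => t /andP[t2 _].
by rewrite gtn_eqF.
Qed.

Variable e : R.
Hypothesis e0 : 0 <= e.
Hypothesis near_optimal : forall Q0, floored eta Q0 ->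
  (mean_cost rho D PX (Q astar) <= mean_cost rho D PX Q0 + e%:E)%E.

Lemma pseudo_regret_le T (g : Omega -> R) : measurable_fun setT g ->
  (forall w, 0 <= g w) ->
  (forall w, \sum_(1 <= t < T.+1) (b (A t w) - b astar) <= g w) ->
  (pseudo_regret rho D (P := P) Q A PX eta T <= (T%:R * e)%:E + \int[P]_w (g w)%:E)%E.
Proof.
move=> mg g0 gA; rewrite /pseudo_regret.
set f := fun w : Omega => _.
have mf : measurable_fun setT f.
  apply: emeasurable_sum => t.
  apply: (@measurable_fun_arm _ _ _ _ (A t) (fun a => mean_cost rho D PX (Q a) - _)%E).
  exact: arm_measurable run t.
have fg w : (f w <= (T%:R * e)%:E + (g w)%:E)%E.
  apply: (@le_trans _ _ (\sum_(1 <= t < T.+1) (b (A t w) - b astar + e)%:E)%E).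
    apply: lee_sum => t _; rewrite mean_costb -addrA EFinD leeD2l//.
    rewrite EFinD EFinN leeNl oppeD// oppeK -EFinN -EFinD.
    apply: le_ereal_inf_tmp => _ [Q0 Q0eta <-].
    by rewrite EFinD EFinN leeBlDr// -mean_costb; exact: near_optimal.
  rewrite sumEFin -EFinD lee_fin big_split/= addrC lerD//.
  by rewrite big_const_nat iter_addr_0 subSS subn0 mulr_natl.
apply: (@le_trans _ _ (\int[P]_w ((T%:R * e)%:E + (g w)%:E))%E).
  (* An arm of the net may lie outside [floored eta] and beat the infimum, so the integrand may be
     negative; its positive part is what gets bounded. *)
  rewrite integralE; apply: (@le_trans _ _ (\int[P]_w f^\+ w)%E).
    by rewrite -[leRHS]sube0 leeB// integral_ge0.
  apply: ge0_le_integral => //.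
  - exact: measurable_funepos.
  - by apply: emeasurable_funD => //; exact/measurable_EFinP.
  - move=> w _; rewrite funeposE ge_max fg -EFinD lee_fin addr_ge0// mulr_ge0//.
rewrite ge0_integralD//.
- by rewrite integral_cst//= probability_setT mule1.
- by move=> w _; rewrite lee_fin mulr_ge0.
- by move=> w _; rewrite lee_fin.
- exact/measurable_EFinP.
Qed.

Let integral_const (C : R) : (\int[P]_w C%:E = C%:E)%E.
Proof.
by rewrite (integral_cst P measurableT C%:E) /= probability_setT mule1.
Qed.

Lemma pseudo_regret_trivial T :
  (pseudo_regret rho D (P := P) Q A PX eta T <= (T%:R * e + T%:R * B)%:E)%E.
Proof.
apply: le_trans (pseudo_regret_le (T := T) (g := cst (T%:R * B)) _ _ _) _.
- exact: measurable_cst.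
- by move=> w; rewrite mulr_ge0.
- move=> w; apply: (@le_trans _ _ (\sum_(1 <= t < T.+1) B)).
    by apply: ler_sum => t _; rewrite lerBlDr (le_trans (b_le _))// lerDl.
  by rewrite big_const_nat iter_addr_0 subSS subn0 mulr_natl.
- by rewrite /= integral_const.
Qed.

Lemma pseudo_regret_single T : (k <= 1)%N ->
  (pseudo_regret rho D (P := P) Q A PX eta T <= (T%:R * e)%:E)%E.
Proof.
move=> k1; apply: le_trans (pseudo_regret_le (T := T) (g := cst 0) _ _ _) _.
- exact: measurable_cst.
- by [].
- move=> w; rewrite big1// => t _; suff -> : A t w = astar by rewrite subrr.
  apply: val_inj => /=; have := ltn_ord (A t w); have := ltn_ord astar.
  by move=> /leq_trans/(_ k1); rewrite ltnS leqn0 => /eqP -> /leq_trans/(_ k1); rewrite ltnS leqn0 => /eqP.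
- by rewrite /= integral_const adde0.
Qed.

Lemma pseudo_regret_lcb T : (0 < T)%N ->
  (pseudo_regret rho D (P := P) Q A PX eta T <=
   (T%:R * e + (B * k%:R + 8 * tau T * Num.sqrt (k%:R * T%:R) + B * (k%:R * ln T%:R)))%:E)%E.
Proof.
move=> T0; set C := B * k%:R + _.
have C0 : 0 <= C.
  by apply: addr_ge0; apply: mulr_ge0 => //; exact: mulr_ge0.
have dc0 w : 0 <= dev_count T w.
  by apply: sumr_ge0 => t _; apply: sumr_ge0 => a _; apply: sumr_ge0.
apply: le_trans (pseudo_regret_le (T := T) (g := fun w => C + B * dev_count T w) _ _ _) _.
- apply: measurable_funD => //; apply: measurable_funM => //; exact: measurable_dev_count.
- by move=> w; rewrite addr_ge0// mulr_ge0.
- by move=> w; exact: pathwise_regret_le.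
rewrite EFinD leeD2l//.
under eq_integral do rewrite EFinD EFinM.
have mdc : measurable_fun setT (fun w => (dev_count T w)%:E).
  by apply/measurable_EFinP; exact: measurable_dev_count.
rewrite ge0_integralD//; last 2 first.
- by move=> w _; rewrite mule_ge0// lee_fin.
- exact: measurable_funeM.
rewrite ge0_integralZl//; last by move=> w _; rewrite lee_fin.
rewrite integral_const [leRHS]EFinD; apply: leeD2l.
by rewrite [leRHS]EFinM; apply: lee_wpmul2l; [rewrite lee_fin|exact: expected_dev_count].
Qed.

End regret.

(** * Choice of the resolution *)

Section rates.
Context {R : realType}.

Lemma opp_ln_le_inv (x : R) : 0 < x -> - ln x <= x^-1.
Proof.
move=> x0; rewrite -lnV ?posrE//; have := le_ln1Dx (x := x^-1 - 1).
rewrite [1 + _]addrC subrK => /(_ _)/le_trans; apply; last by rewrite gerBl.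
by rewrite ltrBDl subrr invr_gt0.
Qed.

Lemma half_le_ln (T : nat) : (2 <= T)%N -> 1 / 2 <= ln T%:R :> R.
Proof.
move=> T2; apply: (@le_trans _ _ (ln 2)); last first.
  by rewrite ler_ln ?posrE ?ltr0n ?ler_nat// (ltn_trans _ T2).
have := @le_ln1Dx R (- 2^-1); have -> : 1 + - 2^-1 = 2^-1 :> R by lra.
rewrite lnV ?posrE// => h; have := h _; lra.
Qed.

(** With [S = sqrt (k T ln T)], every term except [T * e] is at most a multiple of
    [S / eta <= 2 T e]: the radii directly, the others by [k ln T <= S] and [ln T >= 1/2]. *)
Lemma lcb_rate_le (c alpha eta e : R) (T k : nat) : 0 < c -> 0 < alpha ->
  0 < eta < 1 -> 0 < e -> (2 <= T)%N -> 
  k%:R * T%:R * ln T%:R <= 2 * (eta * T%:R * e) ^+ 2 -> k%:R * ln T%:R <= T%:R :> R ->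
  T%:R * e + (- ln eta * k%:R
    + 8 * (c / eta * Num.sqrt (alpha * ln T%:R)) * Num.sqrt (k%:R * T%:R)
    + - ln eta * (k%:R * ln T%:R)) <= (12 + 16 * c * Num.sqrt alpha) * (T%:R * e).
Proof.
move=> c0 alpha0 /andP[eta0 eta1] e0 T2 kTl kl.
have l2 := half_le_ln T2.
set l := ln T%:R in kTl kl l2 *; have l0 : 0 < l by lra.
have T0 : 0 < T%:R :> R by rewrite ltr0n (ltn_trans _ T2).
have k0 : 0 <= k%:R :> R by [].
set B := - ln eta; have Beta : B <= eta^-1 by exact: opp_ln_le_inv.
have B0 : 0 <= B by rewrite /B oppr_ge0 ln_le0// ltW.
set S := Num.sqrt (k%:R * T%:R * l).
have S0 : 0 <= S by exact: sqrtr_ge0.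
have S2 : S ^+ 2 = k%:R * T%:R * l by rewrite sqr_sqrtr// !mulr_ge0// ltW.
have eT0 : 0 < eta * T%:R * e by rewrite !mulr_gt0.
have SE : S <= 2 * (eta * T%:R * e).
  rewrite -ler_sqr ?nnegrE//; last by rewrite mulr_ge0// ltW.
  rewrite S2 (le_trans kTl)//.
  by rewrite [leRHS]exprMn ler_wpM2r ?sqr_ge0//; lra.
have G : S / eta <= 2 * (T%:R * e).
  by rewrite ler_pdivrMr//; apply: (le_trans SE); rewrite le_eqVlt; apply/orP; left; apply/eqP; ring.
have klS : k%:R * l <= S.
  rewrite -ler_sqr ?nnegrE//; last by rewrite mulr_ge0// ltW.
  rewrite S2.
  have -> : k%:R * T%:R * l = k%:R * l * T%:R by ring.
  by rewrite expr2 ler_wpM2l// mulr_ge0// ltW.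
have h1 : B * (k%:R * l) <= S / eta.
  by rewrite [S / eta]mulrC; apply: ler_pM => //; rewrite mulr_ge0// ltW.
have h2 : B * k%:R <= 2 * (B * (k%:R * l)).
  have : 0 <= B * k%:R by rewrite mulr_ge0.
  have -> : B * (k%:R * l) = (B * k%:R) * l by ring.
  by move: (B * k%:R) => x x0; nra.
have h3 : 8 * (c / eta * Num.sqrt (alpha * l)) * Num.sqrt (k%:R * T%:R) =
    8 * c * Num.sqrt alpha * (S / eta).
  have -> : S = Num.sqrt l * Num.sqrt (k%:R * T%:R).
    by rewrite -(sqrtrM _ (ltW l0)) /S mulrC.
  by rewrite (sqrtrM l (ltW alpha0)); field; rewrite gt_eqF.
rewrite h3; set g := S / eta in G h1 h2 h3 *.
have sa0 : 0 <= c * Num.sqrt alpha by rewrite mulr_ge0 ?sqrtr_ge0 ?(ltW c0).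
set x := T%:R * e in G *; have x0 : 0 <= x by rewrite mulr_ge0// ltW.
rewrite -[16 * c * _]mulrA -[8 * c * _]mulrA.
have := ler_wpM2l sa0 G.
move: (c * _) sa0 => s s0 sG.
move: h1 h2; move: (B * _) (B * _) => u v; lra.
Qed.

End rates.

(** * Balancing discretization against learning *)

Section resolution.
Context {R : realType}.
Variables (m : nat) (M eta : R) (T : nat).
Hypotheses (m0 : (0 < m)%N) (M1 : 1 <= M) (eta0 : 0 < eta) (T2 : (2 <= T)%N).

(** The solution [e] of [k T ln T = (eta T e)^2] when [k] is the net size at resolution [e]. *)
Definition optimal_resolution : R :=
  (M `^ (m.-1%:R / 2) / eta ^+ m.+1 * ln T%:R / T%:R) `^ (m.+1%:R)^-1.

Let l0 : 0 < ln T%:R :> R.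
Proof. by apply: lt_le_trans (half_le_ln T2); lra. Qed.

Let T0 : 0 < T%:R :> R.
Proof. by rewrite ltr0n (ltn_trans _ T2). Qed.

Let arg_gt0 : 0 < M `^ (m.-1%:R / 2) / eta ^+ m.+1 * ln T%:R / T%:R.
Proof.
by rewrite divr_gt0// mulr_gt0// divr_gt0 ?exprn_gt0// powR_gt0// (lt_le_trans _ M1).
Qed.

Lemma optimal_resolution_gt0 : 0 < optimal_resolution.
Proof. exact: powR_gt0. Qed.

Lemma optimal_resolutionX :
  optimal_resolution ^+ m.+1 = M `^ (m.-1%:R / 2) / eta ^+ m.+1 * ln T%:R / T%:R.
Proof.
rewrite -powR_mulrn ?(ltW optimal_resolution_gt0)// -powRrM mulVf ?pnatr_eq0//.
by rewrite powRr1// ltW.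
Qed.

Lemma sqrt_exprn : Num.sqrt M ^+ m.-1 = M `^ (m.-1%:R / 2).
Proof.
have M0 : 0 <= M by exact: le_trans M1.
by rewrite -powR12_sqrt// -powR_mulrn ?powR_ge0// -powRrM mulrC.
Qed.

Lemma optimal_resolution_size :
  ((eta * optimal_resolution)^-1 * Num.sqrt M) ^+ m.-1 * (T%:R * ln T%:R) =
  (eta * T%:R * optimal_resolution) ^+ 2.
Proof.
set e := optimal_resolution; have e0 : 0 < e := optimal_resolution_gt0.
have := optimal_resolutionX; rewrite -/e -sqrt_exprn.
case: m m0 => // n _ /= eX; rewrite exprMn exprVn exprMn.
have sE : Num.sqrt M ^+ n * ln T%:R = e ^+ n.+2 * eta ^+ n.+2 * T%:R.
  by rewrite eX; field; rewrite !gt_eqF// exprn_gt0.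
have -> : (eta ^+ n * e ^+ n)^-1 * Num.sqrt M ^+ n * (T%:R * ln T%:R) =
   (eta ^+ n * e ^+ n)^-1 * (Num.sqrt M ^+ n * ln T%:R) * T%:R by ring.
rewrite sE !exprS !expr0; have := exprn_gt0 n e0; have := exprn_gt0 n eta0.
move: (eta ^+ n) (e ^+ n) (T%:R) => u v t u0 v0; clearbody e.
have -> : e * (e * v) * (eta * (eta * u)) * t = u * v * (eta ^+ 2 * e ^+ 2 * t) by ring.
by rewrite mulKf ?mulf_neq0 ?gt_eqF//; ring.
Qed.

(** The power of [lambda] on the left cancels the one inside [Gamma], leaving the root of
    [(T e)^(m+1)]. *)
Lemma rate_resolution (lambda K : R) : 0 < lambda ->
  K * lambda `^ (m.+1%:R)^-1 * ((lambda * eta ^+ m.+1)^-1 * M `^ (m.-1%:R / 2) *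
    T%:R ^+ m * ln T%:R) `^ (m.+1%:R)^-1 = K * (T%:R * optimal_resolution).
Proof.
move=> la0; rewrite -mulrA; congr (_ * _).
set e := optimal_resolution; have e0 : 0 < e := optimal_resolution_gt0.
rewrite -powRM ?(ltW la0)//; last first.
  rewrite !mulr_ge0 ?invr_ge0 ?mulr_ge0 ?(ltW la0) ?exprn_ge0 ?(ltW eta0) ?powR_ge0 ?(ltW l0)//.
have -> : lambda * ((lambda * eta ^+ m.+1)^-1 * M `^ (m.-1%:R / 2) * T%:R ^+ m * ln T%:R) =
    (T%:R * e) ^+ m.+1.
  rewrite exprMn optimal_resolutionX [T%:R ^+ m.+1]exprS.
  have := exprn_gt0 m.+1 eta0; have := l0; have := T0.
  move: (eta ^+ m.+1) (M `^ (m.-1%:R / 2)) (T%:R) (T%:R ^+ m) (ln T%:R) => u v t w l t0 _ u0.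
  by field; rewrite !gt_eqF.
have Te0 : 0 <= T%:R * e by rewrite mulr_ge0// ltW.
by rewrite -powR_mulrn// -powRrM divff ?pnatr_eq0// powRr1.
Qed.

End resolution.

Theorem theorem7 (R : realType) (Y : pointedFinType) (alpha c lambda : R) :
  2 < alpha -> confidence_constant c -> 0 < lambda ->
  exists2 K : R, 0 < K &
  forall (dX : measure_display) (X : measurableType dX) (rho : X -> Y -> R)
    (D eta : R) (T : nat),
  (forall y, measurable_fun setT (rho ^~ y)) ->
  (forall x, exists y, rho x y <= D) ->
  0 < eta < 1 -> @floored R Y eta !=set0 -> (2 <= T)%N ->
  exists2 eps : R, 0 < eps &
    (exists k (Q : 'I_k -> dist R Y), net_used rho D eta eps Q) /\
    forall (PX : probability X R) (k : nat) (Q : 'I_k -> dist R Y)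
      (astar : 'I_k),
    net_used rho D eta eps Q ->
    best_arm rho D PX Q astar -> gap_ratio rho D PX Q astar lambda ->
    forall (dO : measure_display) (Omega : measurableType dO)
      (P : probability Omega R) (A : nat -> Omega -> 'I_k)
      (Xs : nat -> {RV P >-> X}) (Cs : nat -> {RV P >-> codebook Y}),
    lcb_run rho D Q A Xs Cs PX alpha c eta ->
    (pseudo_regret rho D (P := P) Q A PX eta T <=
     (K * (Gamma rho D eta lambda * T%:R ^+ #|Y| * ln T%:R)
            `^ (#|Y|.+1%:R)^-1)%:E)%E.
Proof.
move=> alpha2 cc la0; have [c0 _] := cc.
have alpha0 : 0 < alpha by apply: lt_trans alpha2.
pose m := #|Y|; have m0 : (0 < m)%N by exact: card_gt0_pointed.
(* The 12 serves the one-arm net, whose resolution is known to be below [12 * e0]; the 16 is the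
   factor 8 of the summed radii times the 2 lost in rounding up the net size. *)
pose K0 := 12 + 16 * c * Num.sqrt alpha.
have cs0 : 0 <= 16 * c * Num.sqrt alpha.
  by rewrite mulr_ge0 ?sqrtr_ge0// mulr_ge0// ltW.
have K12 : 12 <= K0 by rewrite lerDl.
have K00 : 0 < K0 by exact: lt_le_trans K12.
exists (K0 * lambda `^ (m.+1%:R)^-1); first by rewrite mulr_gt0// powR_gt0.
move=> dX X rho D eta T mrho rhoD eta01 fne T2.
have /andP[eta0 eta1] := eta01.
set M := max_ball rho D; have M1 : 1 <= M by exact: max_ball_ge1.
have sM0 : 0 < Num.sqrt M by rewrite sqrtr_gt0 (lt_le_trans _ M1).
have TR0 : 0 < T%:R :> R by rewrite ltr0n (ltn_trans _ T2).
have lT0 : 0 < ln T%:R :> R by apply: lt_le_trans (half_le_ln T2); rewrite divr_gt0.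
pose e0 := optimal_resolution m M eta T.
have e00 : 0 < e0 by exact: optimal_resolution_gt0.
have fine_rate : K0 * lambda `^ (m.+1%:R)^-1 *
    (Gamma rho D eta lambda * T%:R ^+ #|Y| * ln T%:R) `^ (#|Y|.+1%:R)^-1 = K0 * (T%:R * e0).
  by rewrite /Gamma -/M; exact: rate_resolution.
rewrite fine_rate.
pose r := eta * e0 / Num.sqrt M.
have r0 : 0 < r by rewrite divr_gt0// mulr_gt0.
(* For 1/12 < r < 1 the grid may have more points than the prescribed net size;
   r = 1 instead gives a single arm, at the price of a constant factor. *)
pose eps := if r <= 12^-1 then e0 else Num.sqrt M / eta.
have eps0 : 0 < eps by rewrite /eps; case: ifP => // _; rewrite divr_gt0.
exists eps => //; split.
  apply: net_exists => //; rewrite /eps -/M; case: ifP => [r12|_]; [left|right] => //.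
  by rewrite mulrCA divff ?gt_eqF// mulr1 divff// gt_eqF.
move=> PX k Q astar [net Qeta kE] best _ dO Omega P A Xs Cs run.
have mean_fin a : mean_cost rho D PX (Q a) = (fine (mean_cost rho D PX (Q a)))%:E.
  rewrite fineK// ge0_fin_numE; last exact: mean_cost_ge0.
  exact: le_lt_trans (mean_cost_le mrho PX eta0 (Qeta a)) (ltry _).
have near Q0 : floored eta Q0 ->
    (mean_cost rho D PX (Q astar) <= mean_cost rho D PX Q0 + eps%:E)%E.
  move=> Q0eta; have [a aQ0] := net _ Q0eta; apply: (le_trans (best a)).
  by apply: (mean_cost_lipschitz mrho PX eta0) => // x; exact: floored_match_prob.
have [r12|r12] := boolP (r <= 12^-1); last first.
  have epsE : eps = Num.sqrt M / eta by rewrite /eps (negbTE r12).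
  have k1 : (k <= 1)%N.
    rewrite -lez_nat kE real_ceil_le_int ?num_real//.
    rewrite /net_size -/M epsE mulrCA divff ?gt_eqF// mulr1 mulVf ?gt_eqF//.
    by rewrite expr1n.
  apply: le_trans (pseudo_regret_single run mean_fin (ltW eps0) near T k1) _.
  rewrite lee_fin mulrCA ler_pM2l//; apply: (@le_trans _ _ (12 * e0)); last by rewrite ler_pM2r.
  move: r12; rewrite epsE -ltNge /r ltr_pdivlMr// => h.
  by rewrite ler_pdivrMr//; move: h; lra.
have epsE : eps = e0 by rewrite /eps r12.
pose ns := net_size rho D eta eps.
have nsE : ns * (T%:R * ln T%:R) = (eta * T%:R * e0) ^+ 2.
  by rewrite /ns epsE; exact: optimal_resolution_size.
have ns1 : 1 <= ns.
  apply: exprn_ege1; rewrite -/M epsE mulrC ler_pdivlMr ?mulr_gt0// mul1r.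
  have : r <= 1 by apply: (le_trans r12); rewrite invf_le1 ?ltr0n// ler1n.
  by rewrite /r ler_pdivrMr// mul1r.
(* Rounding up at most doubles a size that is at least 1. *)
have kns : k%:R <= 2 * ns.
  have -> : k%:R = (Num.ceil ns)%:~R :> R by rewrite -kE.
  by have := ceilB1_lt ns; rewrite intrB; move: ns1; lra.
have kTl : k%:R * T%:R * ln T%:R <= 2 * (eta * T%:R * e0) ^+ 2.
  by rewrite -nsE -mulrA [leRHS]mulrA ler_wpM2r// mulr_ge0// ltW.
rewrite epsE in eps0 near.
have [kl|kl] := leP (k%:R * ln T%:R : R) T%:R.
  have h := pseudo_regret_lcb mrho cc eta01 run Qeta (ltW alpha2) mean_fin
    (ltW eps0) near (ltnW T2).
  apply: (le_trans h) => {h}.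
  by rewrite lee_fin; exact: lcb_rate_le.
have h := pseudo_regret_trivial mrho eta01 run Qeta mean_fin (ltW eps0) near T.
apply: (le_trans h) => {h}.
rewrite lee_fin.
(* From [T < k ln T] follows [T^2 <= k T ln T <= 2 (eta T e0)^2], so even a regret of [1/eta] per
   round is within the rate. *)
have h1 : T%:R <= 2 * (eta * T%:R * e0).
  rewrite -ler_sqr ?nnegrE ?mulr_ge0// ?(ltW eta0) ?(ltW e00)//.
  have h : (T%:R : R) ^+ 2 <= 2 * (eta * T%:R * e0) ^+ 2.
    by apply: le_trans kTl; rewrite expr2 mulrAC ler_wpM2r// ltW.
  by rewrite exprMn; move: h (sqr_ge0 (eta * T%:R * e0)); move: (_ ^+ 2) (_ ^+ 2) => u v; lra.
have h2 : T%:R * - ln eta <= 2 * (T%:R * e0).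
  apply: (@le_trans _ _ (T%:R * eta^-1)); first by rewrite ler_wpM2l// opp_ln_le_inv.
  by rewrite ler_pdivrMr//; move: h1; lra.
have : 12 * (T%:R * e0) <= K0 * (T%:R * e0) by rewrite ler_wpM2r// mulr_ge0// ltW.
have : 0 <= T%:R * e0 by rewrite mulr_ge0// ltW.
by move: h2; lra.
Qed.
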